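(* Let $\xi=\{\xi(x,t):x\in\mathbb{Z}^d,t\ge0\}$ be a real-valued random field that is stationary and ergodic under translations in space and time, is not constant and satisfies $\mathbb{E}(|\xi(0,0)|)<\infty$. Let $\kappa\in[0,\infty)$ and let $u_0:\mathbb{Z}^d\to[0,\infty)$ be bounded. Suppose that: (1) $s\mapsto\xi(x,s)$ is locally integrable for every $x\in\mathbb{Z}^d$, $\mathbb{P}$-almost surely; (2) $\mathbb{E}(e^{q\xi(0,0)})<\infty$ for all $q\ge0$. Then, $\mathbb{P}$-almost surely, the function defined by the Feynman-Kac formula $$u(x,t)=E_x\left(\exp\left\{\int_0^t\xi(X^\kappa(s),t-s)\,ds\right\}u_0(X^\kappa(t))\right),\qquad x\in\mathbb{Z}^d,\ t\ge0,$$ solves the parabolic Anderson equation $$\frac{\partial}{\partial t}u(x,t)=\kappa\Delta u(x,t)+\xi(x,t)u(x,t),\qquad x\in\mathbb{Z}^d,\ t\ge0,$$ with initial condition $u(x,0)=u_0(x)$, $x\in\mathbb{Z}^d$.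
   Context: The field $\xi$ is defined on a probability space $(\Omega,\mathcal{F},\mathbb{P})$ with expectation $\mathbb{E}$. $\Delta$ is the discrete Laplacian acting on the space variable: $\Delta u(x,t)=\sum_{\|y-x\|=1}[u(y,t)-u(x,t)]$, with $\|\cdot\|$ the $l_1$-norm on $\mathbb{Z}^d$. $X^\kappa=(X^\kappa(t))_{t\ge0}$ is the continuous-time simple random walk on $\mathbb{Z}^d$ jumping at total rate $2d\kappa$ (the Markov process with generator $\kappa\Delta$), independent of $\xi$; $P_x$ and $E_x$ denote its law and expectation when it starts at $x$.
   Formalization: As ξ is only locally integrable in time, ''solves'' means: u(x,·) is locally absolutely continuous and satisfies the equation for almost every t ≥ 0 (it can fail at jump times of ξ); the random field ξ(x,·) is taken to be jointly measurable in (ω,s). *)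

(* Defs.v *)
From HB Require Import structures.
From mathcomp Require Import all_boot all_order all_algebra.
From mathcomp Require Import all_classical all_reals all_analysis.

Set Implicit Arguments.
Unset Strict Implicit.
Unset Printing Implicit Defensive.

Import Order.TTheory GRing.Theory Num.Theory.
Import numFieldNormedType.Exports.

Local Open Scope classical_set_scope.
Local Open Scope ring_scope.

(* The lattice Z^d is 'rV[int]_d.  Time is a variable of type R; every notion
   below only looks at nonnegative times. *)

Definition l1norm (d : nat) (x : 'rV[int]_d) : int := \sum_(i < d) `|x 0 i|.

(* The index set has 2d elements, so the finitely supported sum is the sum. *)
Definition laplacian (R : realType) (d : nat) (f : 'rV[int]_d -> R)
    (x : 'rV[int]_d) : R :=
  \sum_(y \in [set y : 'rV[int]_d | l1norm (y - x) = 1]) (f y - f x).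

Section Field.
Context (R : realType) (d : nat) (disp : measure_display)
  (Omega : measurableType disp) (P : probability Omega R).
Implicit Types (xi : 'rV[int]_d -> R -> Omega -> R).

Definition measurable_field xi : Prop :=
  forall x, measurable_fun (setT `*` `[0, +oo[ : set (Omega * R))
              (fun p => xi x p.2 p.1).

(* The product sigma-algebra on the space of paths Z^d x [0, oo) -> R. *)
Definition cylinder_sigma : set (set ('rV[int]_d -> R -> R)) :=
  <<s [set A | exists (x : 'rV[int]_d) (t : R) (B : set R),
        [/\ 0 <= t, measurable B & A = [set f | B (f x t)] ] ] >>.

(* The event that the field translated by (y, s) belongs to A. *)
Definition shift_event xi (y : 'rV[int]_d) (s : R)
    (A : set ('rV[int]_d -> R -> R)) : set Omega :=
  [set w | A (fun x t => xi (x + y) (t + s) w)].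

Definition stationary xi : Prop :=
  forall A, cylinder_sigma A -> forall (y : 'rV[int]_d) (s : R), 0 <= s ->
    P (shift_event xi y s A) = P (shift_event xi 0 0 A).

(* Invariance is required modulo P-null events: as there are uncountably many
   times, a set of the product sigma-algebra which is strictly invariant under
   all translations is empty or full, so ergodicity defined through strictly
   invariant sets would be vacuous. *)
Definition ergodic xi : Prop :=
  forall A, cylinder_sigma A ->
    (forall (y : 'rV[int]_d) (s : R), 0 <= s ->
      P (shift_event xi y s A `+` shift_event xi 0 0 A) = 0%E) ->
    P (shift_event xi 0 0 A) = 0%E \/ P (shift_event xi 0 0 A) = 1%E.

Definition constant_field xi : Prop :=
  exists c : R, {ae P, forall w, forall x (t : R), 0 <= t -> xi x t w = c}.

End Field.

Section RandomWalk.
Context (R : realType) (d : nat) (disp : measure_display)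
  (T : measurableType disp).

(* The sigma-algebra generated by (X r), 0 <= r <= s. *)
Definition past (X : R -> T -> 'rV[int]_d) (s : R) : set (set T) :=
  <<s [set B | exists (r : R) z, 0 <= r <= s /\ B = X r @^-1` [set z] ] >>.

(* X under the family of laws (P x) is a Markov process with generator
   kappa * Laplacian: the time-homogeneous Markov property holds, and the
   semigroup f |-> (x |-> E_x (f (X h))) on bounded functions has at h = 0 the
   derivative kappa * Laplacian in the supremum norm.  In the discrete space
   Z^d, having one-sided limits means being locally constant on that side. *)
Record simple_random_walk (kappa : R) (X : R -> T -> 'rV[int]_d)
    (P : 'rV[int]_d -> probability T R) : Prop := SimpleRandomWalk {
  srw_measurable : forall (t : R) z, 0 <= t -> measurable (X t @^-1` [set z]) ;
  srw_right_continuous : forall w (t : R), 0 <= t ->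
    \forall r \near t^'+, X r w = X t w ;
  srw_left_limit : forall w (t : R), 0 < t ->
    exists z, \forall r \near t^'-, X r w = z ;
  srw_start : forall x, P x (X 0 @^-1` [set x]) = 1%E ;
  srw_markov : forall x (s t : R) A y z, 0 <= s -> 0 <= t -> past X s A ->
    P x (A `&` X s @^-1` [set y] `&` X (s + t) @^-1` [set z]) =
    (P x (A `&` X s @^-1` [set y]) * P y (X t @^-1` [set z]))%E ;
  srw_generator : forall f : 'rV[int]_d -> R,
    (exists M : R, forall x, `|f x| <= M) ->
    forall e : R, 0 < e -> \forall h \near 0^'+, forall x,
      `|(\int[P x]_w f (X h w) - f x) / h - kappa * laplacian f x| <= e }.

(* E_x (exp (int_0^t V (X s) (t - s) ds) u0 (X t)) as an extended real. *)
Definition feynman_kac (X : R -> T -> 'rV[int]_d)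
    (P : 'rV[int]_d -> probability T R) (V : 'rV[int]_d -> R -> R)
    (u0 : 'rV[int]_d -> R) (x : 'rV[int]_d) (t : R) : \bar R :=
  (\int[P x]_w
    (expR (\int[lebesgue_measure]_(s in `[0%R, t]) V (X s w) (t - s))%R
      * u0 (X t w))%:E)%E.

End RandomWalk.

Definition abs_continuous (R : realType) (T : R) (f : R -> R) : Prop :=
  forall e : R, 0 < e -> exists2 delta : R, 0 < delta &
    forall (n : nat) (a b : 'I_n -> R),
      (forall i, 0 <= a i /\ a i <= b i /\ b i <= T) ->
      (forall i j, i != j -> b i <= a j \/ b j <= a i) ->
      \sum_(i < n) (b i - a i) < delta ->
      \sum_(i < n) `|f (b i) - f (a i)| < e.

(* The potential V is only locally integrable in time, so the equation is
   understood in the sense of Caratheodory: each u x is locally absolutely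
   continuous and satisfies the equation at almost every time. *)
Definition solves_pam (R : realType) (d : nat) (kappa : R)
    (V : 'rV[int]_d -> R -> R) (u0 : 'rV[int]_d -> R)
    (u : 'rV[int]_d -> R -> R) : Prop :=
  [/\ forall x, u x 0 = u0 x,
      forall x (T : R), 0 <= T -> abs_continuous T (u x) &
      forall x, {ae (@lebesgue_measure R), forall t : R, 0 <= t ->
        is_derive t 1 (u x)
          (kappa * laplacian (fun y => u y t) x + V x t * u x t)}].

(* Main.v *)
Require Import Defs.
From HB Require Import structures.
From mathcomp Require Import all_boot all_order all_algebra.
From mathcomp Require Import all_classical all_reals all_analysis.
From mathcomp Require Import measurable_realfun ring lra.

(** The core of the argument is deterministic: fix a potential V that is
    locally integrable in time and show that the Feynman-Kac formula solves
    the equation, provided that the formula for the positive part of V is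
    finite at integer times (feynman_kac_solves).

    Suppose first that V >= - C and put W = V + C, a nonnegative potential.
    The exponential of the integral of W along the path is the sum of the
    iterated integrals over ordered times (exp_integral).  Taking expectations
    and applying the Markov property at the times of interaction gives the
    Dyson series (feynman_kac_dyson), whose n-th term sees the potential n
    times.  The uniform convergence assumed of the generator yields
    Kolmogorov's backward equation for the transition probabilities
    (transition_gen, is_derive_transition, kolmogorov_backward).  Integrated
    in time, with the loss terms moved to the other side, it is an identity
    between nonnegative quantities; so it can be summed over end points,
    integrated over interaction times and summed over n by Tonelli's theorem
    alone, without any integrability (dyson_sum_renewal).  The result is the
    integral form of the equation for the expectation, as soon as that
    expectation is known to be locally bounded in time.

    The bound comes from monotonicity: with the weight exp (lambda t), lambda
    being the total jump rate, and a nonnegative potential, the expectation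
    is nondecreasing in t (dyson_weight_ndecr), so its values at integer times
    control it.  For a general V one cuts V off at - n and lets n tend to
    infinity.  Convergence is dominated: the path integrals converge because
    the walk visits finitely many sites in bounded time (walk_finite_range,
    integral_along_walk_lty), and the expectations are at most the one for
    the positive part of V.  The limit satisfies the integral equation
    (solution_integral), hence is absolutely continuous in time and satisfies
    the differential equation at almost every time.

    For the random field it remains to see that, almost surely, the formula
    for the positive part of xi is finite at every site x and every integer
    time n.  By Jensen's inequality the exponential of its integral over
    [0, n] is at most 1 / n times the integral over [0, n] of the exponential
    of n times the positive part.  Taking expectations, Tonelli's theorem and
    stationarity reduce the latter to the exponential moment of xi (0, 0) with
    q = n (expR_integral_le, expectation_path_moment, feynman_kac_pos_lty).
    There are countably many pairs (x, n), and on the resulting event of full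
    probability the deterministic result applies. *)


Set Implicit Arguments.
Unset Strict Implicit.
Unset Printing Implicit Defensive.

Import Order.TTheory GRing.Theory Num.Theory.
Import numFieldNormedType.Exports.

Local Open Scope classical_set_scope.
Local Open Scope ring_scope.

(** * Sums over countable types and Tonelli's theorem *)

Section CountableSum.
Context {R : realType} {I : countType}.
Local Open Scope ereal_scope.
Implicit Types f g : I -> \bar R.

(** Summing along the codes of a countable type makes the theory of series
    applicable; numbers that code nothing contribute 0. *)
Definition csum f : \bar R := \sum_(n <oo) oapp f 0 (pickle_inv n).

Lemma oapp_ge0 f n : (forall i, 0 <= f i) -> 0 <= oapp f 0 (@pickle_inv I n).
Proof. by move=> f0; case: pickle_inv => //=. Qed.

Lemma eq_csum f g : f =1 g -> csum f = csum g.
Proof. by move=> /funext ->. Qed.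

Lemma le_csum f g : (forall i, 0 <= f i) -> (forall i, f i <= g i) ->
  csum f <= csum g.
Proof.
move=> f0 fg; apply: lee_nneseries => [n _ _|n _]; first exact: oapp_ge0.
by case: pickle_inv => //=.
Qed.

Lemma csumD f g : (forall i, 0 <= f i) -> (forall i, 0 <= g i) ->
  csum (fun i => f i + g i) = csum f + csum g.
Proof.
move=> f0 g0; rewrite /csum -nneseriesD; last 2 first.
- by move=> *; exact: oapp_ge0.
- by move=> *; exact: oapp_ge0.
by apply: eq_eseriesr => n _; case: pickle_inv => //=; rewrite adde0.
Qed.

Lemma csumZl (c : R) f : (forall i, 0 <= f i) ->
  csum (fun i => c%:E * f i) = c%:E * csum f.
Proof.
move=> f0; rewrite /csum -nneseriesZl; last by move=> *; exact: oapp_ge0.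
by apply: eq_eseriesr => n _; case: pickle_inv => //=; rewrite mule0.
Qed.

Lemma csum_sum {J : Type} (s : seq J) (F : J -> I -> \bar R) :
  (forall j i, 0 <= F j i) ->
  csum (fun i => \sum_(j <- s) F j i) = \sum_(j <- s) csum (F j).
Proof.
move=> F0; elim: s => [|j s IH].
  rewrite big_nil /csum eseries0// => n _ _.
  by case: pickle_inv => //= i; rewrite big_nil.
rewrite big_cons -IH -csumD//; first by apply: eq_csum => i; rewrite big_cons.
by move=> i; exact: sume_ge0.
Qed.

Lemma csum_single f i0 : (forall i, 0 <= f i) ->
  (forall i, i != i0 -> f i = 0) -> csum f = f i0.
Proof.
move=> f0 fi0; rewrite /csum (@nneseriesD1 _ _ (pickle i0) xpredT)//; last first.
  by move=> n _; exact: oapp_ge0.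
rewrite pickleK_inv/= eseries0 ?adde0// => n _ /= nE.
case E : (pickle_inv n) => [i|]//=; apply: fi0; apply/eqP => ii0.
have := @pickle_invK I n; rewrite /ocancel/= E/= ii0 => ni.
by rewrite ni eqxx in nE.
Qed.

Lemma integral_csum d (T : measurableType d) (mu : {measure set T -> \bar R})
    (D : set T) (F : I -> T -> \bar R) : measurable D ->
  (forall i, measurable_fun D (F i)) -> (forall i x, D x -> 0 <= F i x) ->
  \int[mu]_(x in D) csum (F^~ x) = csum (fun i => \int[mu]_(x in D) F i x).
Proof.
move=> mD mF F0; rewrite /csum integral_nneseries//.
- by apply: eq_eseriesr => n _; case: pickle_inv => //=; rewrite integral0.
- by move=> n; case: pickle_inv => //=.
- by move=> n x Dx; case: pickle_inv => //= i; exact: F0.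
Qed.

(** This replaces conditioning on the position of the walk, which ranges over
    a countable set. *)
Lemma ge0_integral_fibres d (T : measurableType d)
    (mu : {measure set T -> \bar R}) (N : T -> I) (D : set T) (f : T -> \bar R) :
  (forall i, measurable (N @^-1` [set i])) -> measurable D ->
  measurable_fun D f -> (forall x, D x -> 0 <= f x) ->
  \int[mu]_(x in D) f x =
  csum (fun i => \int[mu]_(x in D `&` N @^-1` [set i]) f x).
Proof.
move=> mN mD mf f0.
pose F n := D `&` oapp (fun i => N @^-1` [set i]) set0 (@pickle_inv I n).
have DE : D = \bigcup_n F n.
  apply/seteqP; split=> [x Dx|x [n _ []]//].
  by exists (pickle (N x)) => //; split=> //; rewrite pickleK_inv.
have mF n : measurable (F n).
  by apply: measurableI => //; case: pickle_inv => //=.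
rewrite [in LHS]DE ge0_integral_bigcup//; last 3 first.
- by rewrite -DE.
- by rewrite -DE.
- move=> m n _ _ [x [[_]]]; case Em : pickle_inv => [i|]//= Ni.
  move=> [_]; case En : pickle_inv => [j|]//= Nj.
  have := @pickle_invK I m; rewrite /ocancel Em/= => <-.
  by have := @pickle_invK I n; rewrite /ocancel En/= => <-; rewrite -Ni Nj.
apply: eq_eseriesr => n _; rewrite /F; case: pickle_inv => //=.
by rewrite setI0 integral_set0.
Qed.

(** Measurability only has to be checked on each fibre of N, so a quantity
    evaluated at the random position of the walk is measurable as soon as it
    is at each fixed site. *)
Lemma measurable_glue d d' (T : measurableType d) (T' : measurableType d')
    (N : T -> I) (f : I -> T -> T') :
  (forall i, measurable (N @^-1` [set i])) ->
  (forall i, measurable_fun setT (f i)) ->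
  measurable_fun setT (fun x => f (N x) x).
Proof.
move=> mN mf _ B mB; rewrite setTI.
have -> : (fun x => f (N x) x) @^-1` B =
    \bigcup_i (N @^-1` [set i] `&` f i @^-1` B).
  by apply/seteqP; split=> [x Bx|x [i _ [/= <-]]//]; exists (N x).
apply: countable_bigcupT_measurable; first exact: countableP.
by move=> i; apply: measurableI => //; rewrite -[_ @^-1` _]setTI; exact: mf.
Qed.

Lemma integral_csum_fibres d (T : measurableType d)
    (mu : {measure set T -> \bar R}) (N : T -> I) (D : set T) (h : I -> \bar R) :
  (forall i, measurable (N @^-1` [set i])) -> measurable D ->
  (forall i, 0 <= h i) ->
  \int[mu]_(x in D) h (N x) =
  csum (fun i => h i * mu (D `&` N @^-1` [set i])).
Proof.
move=> mN mD h0; rewrite (@ge0_integral_fibres _ _ _ N)//.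
- apply: eq_csum => i /=.
  transitivity (\int[mu]_(x in D `&` N @^-1` [set i]) cst (h i) x).
    by apply: eq_integral => x; rewrite inE => -[_ /= ->].
  by rewrite integral_cst//; exact: measurableI.
- apply: measurable_funTS; apply: (@measurable_glue _ _ _ _ _ (fun i _ => h i)) => //.
Qed.

End CountableSum.
Global Opaque csum.

Section Tonelli.
Context {R : realType} d1 d2 {T1 : measurableType d1} {T2 : measurableType d2}.
Variables (m1 : {sigma_finite_measure set T1 -> \bar R})
  (m2 : {sigma_finite_measure set T2 -> \bar R}).
Local Open Scope ereal_scope.

Lemma measurable_patch (f : T1 * T2 -> \bar R) D :
  measurable D -> measurable_fun setT f -> measurable_fun setT (f \_ D).
Proof.
by move=> mD mf; apply/(measurable_restrictT _ _).1 => //; exact: measurable_funTS.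
Qed.

Lemma measurable_integral2 (f : T1 * T2 -> \bar R) D2 : measurable D2 ->
  measurable_fun setT f -> (forall p, 0 <= f p) ->
  measurable_fun setT (fun x => \int[m2]_(y in D2) f (x, y)).
Proof.
move=> mD2 mf f0.
rewrite (_ : (fun _ => _) = fubini_F m2 (f \_ (setT `*` D2))); last first.
  apply/funext => x; rewrite /fubini_F [LHS]integral_mkcond.
  by apply: eq_integral => y _; rewrite !patchE in_setX in_setT.
apply: measurable_fun_fubini_tonelli_F.
  by apply: measurable_patch => //; exact: measurableX.
by move=> p; rewrite patchE; case: ifP.
Qed.

Lemma tonelli_dom (f : T1 * T2 -> \bar R) D1 D2 : measurable D1 ->
  measurable D2 -> measurable_fun setT f -> (forall p, 0 <= f p) ->
  \int[m1]_(x in D1) \int[m2]_(y in D2) f (x, y) =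
  \int[m2]_(y in D2) \int[m1]_(x in D1) f (x, y).
Proof.
move=> mD1 mD2 mf f0; pose g := f \_ (D1 `*` D2).
transitivity (\int[m1]_x \int[m2]_y g (x, y)).
  rewrite [LHS]integral_mkcond; apply: eq_integral => x _; rewrite patchE.
  case: ifPn => xD.
    rewrite [LHS]integral_mkcond; apply: eq_integral => y _.
    by rewrite /g !patchE in_setX xD.
  rewrite integral0_eq// => y _; rewrite /g patchE in_setX.
  by rewrite (negbTE xD).
rewrite fubini_tonelli; last 2 first.
- by apply: measurable_patch => //; exact: measurableX.
- by move=> p; rewrite /g patchE; case: ifP.
rewrite [RHS]integral_mkcond; apply: eq_integral => y _; rewrite patchE.
case: ifPn => yD.
  rewrite [RHS]integral_mkcond; apply: eq_integral => x _.
  by rewrite /g !patchE in_setX yD andbT.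
by rewrite integral0_eq// => x _; rewrite /g patchE in_setX (negbTE yD) andbF.
Qed.

End Tonelli.

Section TonelliTriangle.
Context {R : realType}.
Local Open Scope ereal_scope.
Local Notation mu := (@lebesgue_measure R).

Lemma integral_itv_if (f : R -> \bar R) (P : R -> bool) (D D' : set R) :
  (forall x, D' x <-> D x /\ P x) ->
  \int[mu]_(x in D') f x = \int[mu]_(x in D) (if P x then f x else 0).
Proof.
move=> DP; rewrite (_ : D' = D `&` [set x | P x]); last first.
  by apply/seteqP; split => x /DP.
rewrite integral_mkcondr; apply: eq_integral => x _.
by rewrite patchE mem_setE.
Qed.

Lemma measurable_ler_if d (T : measurableType d) (a b : T -> R) (f : T -> \bar R) :
  measurable_fun setT a -> measurable_fun setT b -> measurable_fun setT f ->
  measurable_fun setT (fun x => if (a x <= b x)%R then f x else 0).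
Proof.
move=> ma mb mf; apply: measurable_fun_ifT => //.
exact: measurable_fun_ler.
Qed.

(** Both sides integrate f over the triangle 0 <= r <= s <= t, whose indicator
    turns them into integrals over a square. *)
Lemma tonelli_triangle (f : R * R -> \bar R) (t : R) :
  measurable_fun setT f -> (forall p, 0 <= f p) ->
  \int[mu]_(r in `[0%R, t]) \int[mu]_(s in `[r, t]) f (r, s) =
  \int[mu]_(s in `[0%R, t]) \int[mu]_(r in `[0%R, s]) f (r, s).
Proof.
move=> mf f0; pose g (p : R * R) := if (p.1 <= p.2)%R then f p else 0.
transitivity (\int[mu]_(r in `[0%R, t]) \int[mu]_(s in `[0%R, t]) g (r, s)).
  apply: eq_integral => r; rewrite inE/= in_itv/= => /andP[r0 rt].
  apply: integral_itv_if => s /=; rewrite !in_itv/=; split.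
    by move=> /andP[rs ->]; rewrite rs (le_trans r0 rs).
  by case=> /andP[_ ->] ->.
rewrite tonelli_dom//; last 2 first.
- exact: measurable_ler_if.
- by move=> p; rewrite /g; case: ifP.
apply: eq_integral => s; rewrite inE/= in_itv/= => /andP[s0 st].
apply/esym/integral_itv_if => r /=; rewrite !in_itv/=; split.
  by move=> /andP[-> rs]; rewrite rs (le_trans rs st).
by case=> /andP[-> _] ->.
Qed.

Lemma measurable_integral_0x d (T : measurableType d) (a : T -> R) (f : T * R -> \bar R) :
  measurable_fun setT a ->
  measurable_fun setT f -> (forall p, 0 <= f p) ->
  measurable_fun setT (fun x => \int[mu]_(r in `[0%R, a x]) f (x, r)).
Proof.
move=> ma mf f0; pose g (p : T * R) := if (p.2 <= a p.1)%R then f p else 0.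
rewrite (_ : (fun _ => _) = (fun x => \int[mu]_(r in `[0%R, +oo[) g (x, r))).
  apply: measurable_integral2 => //.
    by apply: measurable_ler_if => //; exact: measurableT_comp.
  by move=> p; rewrite /g; case: ifP.
apply/funext => x; apply: integral_itv_if => r /=; rewrite !in_itv/= andbT.
by split; [move=> /andP[-> ->]|case=> -> ->].
Qed.

Lemma measurable_integral_x1 (f : R * R -> \bar R) (t : R) :
  measurable_fun setT f -> (forall p, 0 <= f p) ->
  measurable_fun setT (fun r => \int[mu]_(s in `[r, t]) f (r, s)).
Proof.
move=> mf f0; pose g (p : R * R) := if (p.1 <= p.2)%R then f p else 0.
rewrite (_ : (fun _ => _) = (fun r => \int[mu]_(s in `]-oo, t]) g (r, s))).
  apply: measurable_integral2 => //; first exact: measurable_ler_if.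
  by move=> p; rewrite /g; case: ifP.
apply/funext => r; apply: integral_itv_if => s /=; rewrite !in_itv/=.
by split=> [/andP[-> ->]|[-> ->]].
Qed.

(** The reflected measure agrees with Lebesgue measure on half-open intervals,
    and these determine it. *)
Lemma lebesgue_measure_reflect (t : R) (A : set R) : measurable A ->
  pushforward mu (fun x => t - x : measurableTypeR R)%R A = mu A.
Proof.
have mr : measurable_fun setT (fun x : measurableTypeR R => t - x : measurableTypeR R)%R.
  by apply: measurable_funB => //; exact: measurable_cst.
move=> mA; pose m : {measure set (measurableTypeR R) -> \bar R} :=
  measure_function_pushforward__canonical__measure_function_Measure mu mr.
have := @lebesgue_measure_unique R m.
move=> /(_ _ A mA) h; apply/esym/h => _ [[a b]] _ <-.
rewrite /m/= /pushforward.
rewrite (_ : _ @^-1` _ = `[(t - b)%R, (t - a)%R[%classic); last first.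
  apply/seteqP; split=> x /=; rewrite !in_itv/= => /andP[? ?]; apply/andP; split; lra.
rewrite !lebesgue_measure_itv/= !lte_fin.
rewrite ltrD2l ltrN2; case: ifP => // _.
by rewrite -!EFinD; congr EFin; lra.
Qed.

Lemma integral_reflect (t a : R) (f : R -> \bar R) :
  measurable_fun setT f -> (forall r, 0 <= f r) ->
  \int[mu]_(r in `[a, t]) f r = \int[mu]_(r in `[0%R, (t - a)%R]) f (t - r)%R.
Proof.
move=> mf f0.
have mr : measurable_fun setT (fun x : measurableTypeR R => t - x : measurableTypeR R)%R.
  by apply: measurable_funB => //; exact: measurable_cst.
transitivity (\int[pushforward mu (fun x => t - x : measurableTypeR R)%R]_(r in `[a, t]) f r).
  by apply: eq_measure_integral => A mA _; exact: esym (lebesgue_measure_reflect t mA).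
rewrite ge0_integral_pushforward//; last exact: measurable_funTS.
rewrite (_ : _ @^-1` _ = `[0%R, (t - a)%R]%classic)//.
by apply/seteqP; split=> x /=; rewrite !in_itv/= => /andP[? ?]; apply/andP; split; lra.
Qed.

End TonelliTriangle.

(** * Iterated integrals and the exponential *)

Section IteratedIntegrals.
Context {R : realType}.
Local Open Scope ereal_scope.
Local Notation mu := (@lebesgue_measure R).

Lemma ge0_integral_itv_split (f : R -> \bar R) (a s t : R) :
  measurable_fun setT f -> (forall r, 0 <= f r) -> (a <= s)%R -> (s <= t)%R ->
  \int[mu]_(r in `[a, t]) f r =
  \int[mu]_(r in `[a, s]) f r + \int[mu]_(r in `[s, t]) f r.
Proof.
move=> mf f0 as_ st.
rewrite (@itv_bndbnd_setU _ _ _ (BRight s)) ?bnd_simp//.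
rewrite ge0_integral_setU//; last 2 first.
- exact: measurable_funTS.
- apply/disj_setPLR => x /=; rewrite !in_itv/= => /andP[_ xs].
  by apply/negP; rewrite negb_and -leNgt xs.
by rewrite integral_itv_obnd_cbnd//; exact: measurable_funTS.
Qed.

Variable f : R -> \bar R.
Hypotheses (mf : measurable_fun setT f) (f0 : forall r, 0 <= f r).

(** The integral of f (r_1) ... f (r_n) over t >= r_1 >= ... >= r_n >= 0. *)
Fixpoint iter_integral n (t : R) : \bar R :=
  if n is n'.+1 then \int[mu]_(r in `[0%R, t]) (f r * iter_integral n' r) else 1.

Lemma iter_integral_ge0 n t : 0 <= iter_integral n t.
Proof.
elim: n t => //= n IH t; apply: integral_ge0 => r _; exact: mule_ge0.
Qed.

Lemma measurable_iter_integral n : measurable_fun setT (iter_integral n).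
Proof.
elim: n => /= [|n IH]; first exact: measurable_cst.
apply: (@measurable_integral_0x _ _ _ id (fun p => f p.2 * iter_integral n p.2)) => //.
  by apply: emeasurable_funM; exact: measurableT_comp.
by move=> p; rewrite mule_ge0// iter_integral_ge0.
Qed.

(** A further time can be inserted into n ordered times at n + 1 places. In
    the induction the further time r is compared with the largest of the
    ordered times, s: either r <= s, and the induction hypothesis applies to
    the integral up to s, or r is the new largest time. *)
Lemma mul_iter_integral n t : (0 <= t)%R ->
  \int[mu]_(r in `[0%R, t]) f r * iter_integral n t =
  n.+1%:R%:E * iter_integral n.+1 t.
Proof.
have mI n' := measurable_iter_integral n'.
have I0 n' t' := iter_integral_ge0 n' t'.
have mfI n' : measurable_fun setT (fun r => f r * iter_integral n' r).
  exact: emeasurable_funM.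
elim: n t => [|n IH] t t0.
  by rewrite mule1 mul1e/=; apply: eq_integral => r _; rewrite mule1.
rewrite [in LHS]/= -ge0_integralZl//; last 3 first.
- by apply: measurable_funTS; exact: mfI.
- by move=> r _; rewrite mule_ge0.
- by apply: integral_ge0 => r _.
transitivity (\int[mu]_(s in `[0%R, t])
   (n.+1%:R%:E * (f s * iter_integral n.+1 s)
    + \int[mu]_(r in `[s, t]) (f r * (f s * iter_integral n s)))).
  apply: eq_integral => s; rewrite inE/= in_itv/= => /andP[s0 st].
  rewrite (ge0_integral_itv_split _ _ s0 st)//.
  rewrite ge0_muleDl; [|exact: integral_ge0|exact: integral_ge0].
  congr (_ + _); first by rewrite muleCA IH// muleCA.
  rewrite ge0_integralZr//; first exact: measurable_funTS.
  by rewrite mule_ge0.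
rewrite ge0_integralD//; last 4 first.
- by move=> s _; rewrite mule_ge0// mule_ge0.
- by apply: measurable_funTS; apply: emeasurable_funM => //; exact: mfI n.+1.
- by move=> s _; apply: integral_ge0 => r _; rewrite mule_ge0// mule_ge0.
- apply: measurable_funTS.
  apply: (@measurable_integral_x1 _ (fun p => f p.2 * (f p.1 * iter_integral n p.1))).
    apply: emeasurable_funM; first exact: measurableT_comp.
    by apply: (@measurableT_comp _ _ _ _ _ _ (fun r => f r * iter_integral n r)).
  by move=> p; rewrite !mule_ge0.
rewrite ge0_integralZl//; last 2 first.
- by apply: measurable_funTS; exact: mfI n.+1.
- by move=> s _; rewrite mule_ge0.
rewrite (@tonelli_triangle _ (fun p => f p.2 * (f p.1 * iter_integral n p.1)))//=; last 2 first.
- apply: emeasurable_funM; first exact: measurableT_comp.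
  by apply: (@measurableT_comp _ _ _ _ _ _ (fun r => f r * iter_integral n r)).
- by move=> p; rewrite !mule_ge0.
rewrite -[in RHS]natr1 EFinD ge0_muleDl//.
rewrite mul1e; congr (_ + _).
apply: eq_integral => s _; rewrite ge0_integralZl//.
- by apply: measurable_funTS; exact: (mfI n).
- by move=> r _; rewrite mule_ge0.
Qed.

Lemma iter_integralE n t : (0 <= t)%R -> \int[mu]_(r in `[0%R, t]) f r < +oo ->
  iter_integral n t =
  (fine (\int[mu]_(r in `[0%R, t]) f r) ^+ n / n`!%:R)%:E.
Proof.
move=> t0 ft.
have fE : \int[mu]_(r in `[0%R, t]) f r = (fine (\int[mu]_(r in `[0%R, t]) f r))%:E.
  by rewrite fineK// ge0_fin_numE//; exact: integral_ge0.
elim: n => [|n IH]; first by rewrite expr0 fact0 divr1.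
have := mul_iter_integral n t0; rewrite IH fE -EFinM => /esym.
set q := fine _ => /(congr1 (fun x => (n.+1%:R^-1)%:E * x)).
rewrite muleA -EFinM mulVf ?pnatr_eq0// mul1e => ->.
rewrite -EFinM; congr EFin; rewrite factS natrM invfM exprS.
by move: (q ^+ n)%R n.+1%:R%R n`!%:R%R => a b c /=; ring.
Qed.

(** The iterated integrals are the terms of the exponential series. *)
Lemma exp_integral t : (0 <= t)%R -> \int[mu]_(r in `[0%R, t]) f r < +oo ->
  (expR (fine (\int[mu]_(r in `[0%R, t]) f r)))%:E =
  \sum_(n <oo) iter_integral n t.
Proof.
move=> t0 ft; rewrite -EFin_lim; last exact: is_cvg_series_exp_coeff.
congr (limn _); apply/funext => n.
rewrite /= -sumEFin; apply: eq_bigr => i _; by rewrite iter_integralE.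
Qed.

End IteratedIntegrals.

(** * The walk and its semigroup *)

Section Walk.
Context {R : realType} {d : nat} {disp : measure_display} {T : measurableType disp}.
Variables (kappa : R) (X : R -> T -> 'rV[int]_d) (P : 'rV[int]_d -> probability T R).
Hypothesis srw : simple_random_walk kappa X P.
Notation Z := ('rV[int]_d).

(** The path is extended to negative times by its initial value, so that
    measurability in time can be stated on the whole line. *)
Definition walk (r : R) (w : T) : Z := X (Num.max 0 r) w.

Lemma walkE r : 0 <= r -> walk r = X r.
Proof. by move=> r0; rewrite /walk max_r. Qed.

Lemma measurable_walk r z : measurable (walk r @^-1` [set z]).
Proof. by apply: (srw_measurable srw); rewrite le_max lexx. Qed.

(** The first point after r of the grid of mesh 1 / (n + 1): an approximation
    from the right, as right-continuity requires. *)
Let approx n (r : R) : R := (Num.truncn (n.+1%:R * Num.max 0 r)).+1%:R / n.+1%:R.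

Let approx_gt n r : Num.max 0 r < approx n r.
Proof. by rewrite ltr_pdivlMr// mulrC truncnS_gt. Qed.

Let approx_le n r : approx n r <= Num.max 0 r + n.+1%:R^-1.
Proof.
rewrite ler_pdivrMr// mulrDl mulVf ?pnatr_eq0// -natr1 lerD2r mulrC.
by rewrite truncn_le mulr_ge0// le_max lexx.
Qed.

Let walk_approx (r : R) w : \forall n \near \oo, walk (approx n r) w = walk r w.
Proof.
have m0 : 0 <= Num.max 0 r by rewrite le_max lexx.
have := srw_right_continuous srw w m0.
rewrite near_withinE => /nbhs_ballP[e /= e0 he].
have ne := near_infty_natSinv_lt (PosNum e0).
near=> n; rewrite walkE; last exact: ltW (le_lt_trans m0 (approx_gt n r)).
rewrite [RHS]/walk; apply: he; last exact: approx_gt.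
rewrite /ball/= ltr_distlC; apply/andP; split.
  by rewrite ltrBlDr (lt_trans (approx_gt n r))// ltrDl.
rewrite (le_lt_trans (approx_le n r))// ltrD2l.
by near: n; exact: ne.
Unshelve. all: by end_near. Qed.

(** Right-continuity gives joint measurability: the walk is the eventual value
    of its discretisations, which are measurable in each variable. *)
Lemma measurable_walk_joint z :
  measurable [set p : R * T | walk p.1 p.2 = z].
Proof.
pose S n := [set p : R * T | walk (approx n p.1) p.2 = z].
have mS n : measurable (S n).
  pose F k := [set r : R | Num.truncn (n.+1%:R * Num.max 0 r) = k].
  have -> : S n = \bigcup_k (F k `*` (walk (k.+1%:R / n.+1%:R) @^-1` [set z])).
    apply/seteqP; split=> [[r w] /= wz|[r w] [k _ [/= <-]]//].
    by exists (Num.truncn (n.+1%:R * Num.max 0 r)).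
  apply: bigcupT_measurable => k; apply: measurableX; last exact: measurable_walk.
  rewrite (_ : F k = (fun r => n.+1%:R * Num.max 0 r) @^-1` `[k%:R, k.+1%:R[).
    rewrite -[_ @^-1` _]setTI.
    have mf : measurable_fun setT (fun r : R => n.+1%:R * Num.max 0 r).
      apply: measurable_funM; first exact: measurable_cst.
      by apply: measurable_maxr => //; exact: measurable_cst.
    exact: mf.
  apply/seteqP; split=> r; rewrite /F/= in_itv/= => h.
    by rewrite -truncn_eq ?h// mulr_ge0// le_max lexx.
  by apply/eqP; rewrite truncn_eq// mulr_ge0// le_max lexx.
rewrite (_ : [set p | _] = \bigcup_m \bigcap_(n in [set n | (m <= n)%N]) S n).
  apply: bigcupT_measurable => m; exact: bigcap_measurableType.
apply/seteqP; split=> [[r w] /= wz|[r w] [m _ mS']] /=.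
  have [m _ mw] := walk_approx r w.
  by exists m => // n /= mn; rewrite /S/= mw.
have [m' _ mw] := walk_approx r w.
rewrite -(mw (maxn m m')); last by rewrite /= leq_maxr.
by apply: (mS' (maxn m m')); rewrite /= leq_maxl.
Qed.

Lemma measurable_walk_comp d1 (S : measurableType d1) (a : S -> R) (b : S -> T) z :
  measurable_fun setT a -> measurable_fun setT b ->
  measurable ((fun s => walk (a s) (b s)) @^-1` [set z]).
Proof.
move=> ma mb.
have mab : measurable_fun setT (fun s => (a s, b s)) by exact: measurable_fun_pair.
have := mab measurableT _ (measurable_walk_joint z).
by rewrite setTI.
Qed.

Lemma measurable_along_walk d1 d2 (S : measurableType d1) (S' : measurableType d2)
    (a : S -> R) (b : S -> T) (f : Z -> S -> S') :
  measurable_fun setT a -> measurable_fun setT b ->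
  (forall z, measurable_fun setT (f z)) ->
  measurable_fun setT (fun s => f (walk (a s) (b s)) s).
Proof.
move=> ma mb mf.
apply: (@measurable_glue _ _ _ _ _ (fun s => walk (a s) (b s))) => // z.
exact: measurable_walk_comp.
Qed.

Local Open Scope ereal_scope.

Definition semigroup (t : R) (h : Z -> \bar R) (x : Z) : \bar R :=
  \int[P x]_w h (walk t w).

Lemma semigroup_ge0 t h x : (forall z, 0 <= h z) -> 0 <= semigroup t h x.
Proof. by move=> h0; apply: integral_ge0. Qed.

Lemma semigroupE t h x : (forall z, 0 <= h z) ->
  semigroup t h x = csum (fun z => h z * P x (walk t @^-1` [set z])).
Proof.
move=> h0; rewrite /semigroup.
have mw z : measurable (walk t @^-1` [set z]) by exact: measurable_walk.
have -> := integral_csum_fibres (P x) mw measurableT h0.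
by apply: eq_csum => z; rewrite setTI.
Qed.

Lemma past_measurable s A : (0 <= s)%R -> past X s A -> measurable A.
Proof.
move=> s0; apply: smallest_sub; first exact: sigma_algebra_measurable.
move=> _ [r [z [/andP[r0 _] ->]]]; exact: (srw_measurable srw).
Qed.

Lemma past_setI s A B : past X s A -> past X s B -> past X s (A `&` B).
Proof.
move=> pA pB.
by have := @measurableI _ (g_sigma_algebraType [set B | exists (r : R) z, (0 <= r <= s)%R /\ B = X r @^-1` [set z] ]) A B pA pB.
Qed.

Lemma pastT s : past X s setT.
Proof.
exact: (@measurableT _ (g_sigma_algebraType [set B | exists (r : R) z, (0 <= r <= s)%R /\ B = X r @^-1` [set z] ])).
Qed.

Lemma past_walk s r z : (0 <= r <= s)%R -> past X s (walk r @^-1` [set z]).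
Proof.
move=> rs; have [r0 _] := andP rs; apply: sub_sigma_algebra; exists r, z; split=> //.
by rewrite walkE.
Qed.

Lemma sub_past r s A : (r <= s)%R -> past X r A -> past X s A.
Proof.
move=> rs; apply: smallest_sub; first exact: smallest_sigma_algebra.
move=> _ [q [z [/andP[q0 qr] ->]]]; apply: sub_sigma_algebra; exists q, z; split=> //.
by rewrite q0 (le_trans qr rs).
Qed.

(** The Markov property of the definition speaks of single sites; summing it
    over the position y at time s and the position z at time s + t extends it
    to nonnegative functions. *)
Lemma markov_semigroup x (s t : R) A h : (0 <= s)%R -> (0 <= t)%R ->
  past X s A -> (forall z, 0 <= h z) ->
  \int[P x]_(w in A) h (walk (s + t) w) =
  \int[P x]_(w in A) semigroup t h (walk s w).
Proof.
move=> s0 t0 pA h0; have mA := past_measurable s0 pA.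
have sh0 z : 0 <= semigroup t h z by exact: semigroup_ge0.
have mw r z : measurable (walk r @^-1` [set z]) by exact: measurable_walk.
have mh : measurable_fun A (fun w => h (walk (s + t) w)).
  apply: measurable_funTS.
  by apply: (@measurable_along_walk _ _ _ _ (fun=> (s + t)%R) id (fun z _ => h z)).
have msh : measurable_fun A (fun w => semigroup t h (walk s w)).
  apply: measurable_funTS.
  by apply: (@measurable_along_walk _ _ _ _ (fun=> s) id (fun z _ => semigroup t h z)).
rewrite (ge0_integral_fibres (P x) (mw s) mA mh (fun w _ => h0 _)).
rewrite (ge0_integral_fibres (P x) (mw s) mA msh (fun w _ => sh0 _)).
apply: eq_csum => y.
have mB : measurable (A `&` walk s @^-1` [set y]) by exact: measurableI.
rewrite (integral_csum_fibres (P x) (mw (s + t)%R) mB h0).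
transitivity (\int[P x]_(w in A `&` walk s @^-1` [set y]) cst (semigroup t h y) w); last first.
  by apply: eq_integral => w; rewrite inE => -[_ /= ->].
rewrite integral_cst// semigroupE//.
(* pulling the factor c out of the sum over z requires it to be finite *)
set c := (X in _ = _ * X).
have cE : c = (fine c)%:E by rewrite fineK// /c fin_num_measure.
rewrite cE muleC -csumZl; last by move=> z; rewrite mule_ge0.
apply: eq_csum => z; rewrite -cE !walkE ?addr_ge0//.
rewrite muleCA; congr (_ * _).
by rewrite /c walkE//; exact: (srw_markov srw).
Qed.

Lemma semigroupD x (s t : R) h : (0 <= s)%R -> (0 <= t)%R ->
  (forall z, 0 <= h z) ->
  semigroup (s + t) h x = semigroup s (semigroup t h) x.
Proof. by move=> s0 t0 h0; apply: markov_semigroup => //; exact: pastT. Qed.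

Lemma semigroup0 h x : (forall z, 0 <= h z) -> semigroup 0 h x = h x.
Proof.
move=> h0; rewrite semigroupE// (csum_single (i0 := x)); first last.
- move=> z zx; suff -> : P x (walk 0 @^-1` [set z]) = 0 by rewrite mule0.
  have m0 := measurable_walk 0; apply/eqP; rewrite eq_le measure_ge0 andbT.
  have -> : 0 = P x (~` (walk 0 @^-1` [set x])).
    by rewrite probability_setC// walkE// (srw_start srw) subee.
  apply: le_measure; rewrite ?inE//; first exact: measurableC.
  by move=> w /= wz wx; rewrite -wz wx eqxx in zx.
- by move=> z; rewrite mule_ge0.
by rewrite walkE// (srw_start srw) mule1.
Qed.

End Walk.

(** * The Laplacian and the transition probabilities *)

Section Neighbours.
Context {R : realType} {d : nat}.
Notation Z := ('rV[int]_d).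

(** A neighbour of x differs from it by a vector with entries in {-1, 0, 1}. *)
Lemma finite_neighbours (x : Z) : finite_set [set y : Z | l1norm (y - x) = 1].
Proof.
pose g (m : 'rV['I_3]_d) : Z := x + map_mx (fun k : 'I_3 => k%:Z - 1) m.
apply: (@sub_finite_set _ _ (g @` setT)); last exact/finite_image/finite_finset.
move=> y /= xy1.
exists (map_mx (fun k : int => inord (absz (k + 1)%R) : 'I_3) (y - x)) => //.
apply/rowP => i; rewrite !mxE.
have : `|y 0 i - x 0 i| <= 1.
  rewrite -xy1 /l1norm (bigD1 i)//= !mxE lerDl; exact: sumr_ge0.
move: (y 0 i) (x 0 i) => a b ab.
have [h1 h2] : -1 <= a - b /\ a - b <= 1 by move: ab; rewrite ler_norml => /andP[].
have k0 : 0 <= a - b + 1 by lra.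
have k3 : (absz (a - b + 1)%R < 3)%N by rewrite -ltz_nat gez0_abs//; lra.
by rewrite inordK// gez0_abs//; lra.
Qed.

Definition neighbours (x : Z) : seq Z :=
  finmap.enum_fset (fset_set [set y : Z | l1norm (y - x) = 1]).

Lemma laplacianE (f : Z -> R) x :
  laplacian f x = \sum_(y <- neighbours x) (f y - f x).
Proof. by rewrite /laplacian fsbig_finite//; exact: finite_neighbours. Qed.

(** The gain term and the loss term are separated because the equations below
    are first proved between nonnegative quantities, with the loss on the
    other side. *)
Lemma laplacian_gain_loss (f : Z -> R) x :
  laplacian f x = \sum_(y <- neighbours x) f y - (size (neighbours x))%:R * f x.
Proof.
rewrite laplacianE big_split/=; congr (_ + _).
by rewrite sumrN big_const_seq count_predT iter_addr_0 mulr_natl.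
Qed.

End Neighbours.

Section Transition.
Context {R : realType} {d : nat} {disp : measure_display} {T : measurableType disp}.
Variables (kappa : R) (X : R -> T -> 'rV[int]_d) (P : 'rV[int]_d -> probability T R).
Hypothesis srw : simple_random_walk kappa X P.
Notation Z := ('rV[int]_d).

(** The target z comes before the starting point x, because transition t z is
    the function to which the generator is applied. *)
Definition transition (t : R) (z x : Z) : R := fine (P x (walk X t @^-1` [set z])).

Lemma transitionE t z x : P x (walk X t @^-1` [set z]) = (transition t z x)%:E.
Proof. by rewrite /transition fineK// fin_num_measure//; exact: (measurable_walk srw). Qed.

Lemma transition_ge0 t z x : 0 <= transition t z x.
Proof. by rewrite fine_ge0. Qed.

Lemma transition_le1 t z x : transition t z x <= 1.
Proof. by rewrite -lee_fin -transitionE probability_le1//; exact: (measurable_walk srw). Qed.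

Definition delta (z y : Z) : R := (y == z)%:R.

Lemma semigroup_delta t z x :
  semigroup X P t (EFin \o delta z) x = (transition t z x)%:E.
Proof.
rewrite (semigroupE srw); last by move=> y; rewrite lee_fin ler0n.
rewrite (csum_single (i0 := z)) => [|y|y yz].
- by rewrite /= /delta eqxx mul1e transitionE.
- by rewrite mule_ge0// lee_fin ler0n.
- by rewrite /= /delta (negbTE yz) mul0e.
Qed.

Lemma transitionD s t z x : 0 <= s -> 0 <= t ->
  (transition (s + t) z x)%:E = semigroup X P s (EFin \o transition t z) x.
Proof.
move=> s0 t0; rewrite -semigroup_delta (semigroupD srw)//; last first.
  by move=> y; rewrite lee_fin ler0n.
by congr (semigroup _ _ _ _ _); apply/funext => y; rewrite semigroup_delta.
Qed.

Lemma transition0 z x : transition 0 z x = delta z x.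
Proof.
apply: EFin_inj; rewrite -semigroup_delta (semigroup0 srw)//.
by move=> y; rewrite lee_fin ler0n.
Qed.

Lemma integrable_walk t (f : Z -> R) (M : R) x : (forall y, `|f y| <= M) ->
  (P x).-integrable setT (EFin \o (fun w => f (walk X t w))).
Proof.
move=> fM; apply: measurable_bounded_integrable => //.
- by rewrite (le_lt_trans (probability_le1 _ _))// ltry.
- by apply: (@measurable_glue _ _ _ _ _ (walk X t) (fun z _ => f z)) => // z; exact: (measurable_walk srw).
- exists M; split; first exact: num_real.
  by move=> N MN w _ /=; rewrite (le_trans (fM _))// ltW.
Qed.

Let gen (f : Z -> R) x := kappa * laplacian f x.

(** The generator is given at time 0 only. By the Markov property the
    difference quotient at time t is the mean, over the position at time t, of
    the quotient at time 0 for the indicator of z; so it is within e of b t x,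
    the mean of the generator applied to that indicator, and this uniformly in
    x and t. On the other hand transition (t + h) z x is also the mean of
    transition t z over the position at time h, and the generator applied to
    the bounded function transition t z identifies b t x with gen (transition
    t z) x. The uniformity in t is what gives access to left derivatives
    later. *)
Lemma transition_gen z (e : R) : 0 < e -> exists2 h0 : R, 0 < h0 &
  forall h, 0 < h < h0 -> forall x t, 0 <= t ->
  `|(transition (t + h) z x - transition t z x) / h - gen (transition t z) x| <= e.
Proof.
have tb t y : `|transition t z y| <= 1.
  by rewrite ger0_norm ?transition_ge0 ?transition_le1.
have ib y : `|delta z y| <= 1 by rewrite ger0_norm ?ler0n// lern1 leq_b1.
have eind h y : 0 <= h -> \int[P y]_w delta z (X h w) = transition h z y.
  by move=> h0; rewrite /Rintegral -(walkE X h0); have := semigroup_delta h z y; rewrite /semigroup /= => ->.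
have etr h s y : 0 <= h -> 0 <= s ->
    \int[P y]_w transition s z (X h w) = transition (h + s) z y.
  by move=> h0 s0; rewrite /Rintegral -(walkE X h0); have := transitionD z y h0 s0; rewrite /semigroup/= => <-.
(* the generator applied to the indicator of z, uniformly in the starting point *)
have gi (e1 : R) : 0 < e1 -> exists2 h0 : R, 0 < h0 & forall h, 0 < h < h0 ->
    forall y, `|(transition h z y - delta z y) / h - gen (delta z) y| <= e1.
  move=> e10.
  have := srw_generator srw (ex_intro _ 1 ib) e10.
  rewrite near_withinE => /nbhs_ballP[h0 /= h00 hb].
  exists h0 => // h /andP[hh0 hh] y; rewrite -eind; last exact: ltW.
  by apply: hb => //; rewrite /ball/= sub0r normrN gtr0_norm.
have [M gM] : exists M, forall y, `|gen (delta z) y| <= M.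
  have [h0 h00 hb] := gi _ ltr01.
  have hh : 0 < h0 / 2 < h0 by lra.
  exists (1 / (h0 / 2) + 1) => y.
  have -> : gen (delta z) y = (transition (h0 / 2) z y - delta z y) / (h0 / 2)
     - ((transition (h0 / 2) z y - delta z y) / (h0 / 2) - gen (delta z) y) by ring.
  apply: le_trans (ler_normB _ _) _; apply: lerD; last exact: hb.
  rewrite normrM (ger0_norm (_ : 0 <= (h0 / 2)^-1)); last by rewrite invr_ge0; lra.
  rewrite ler_wpM2r ?invr_ge0; [by []|lra|].
  have := transition_ge0 (h0 / 2) z y; have := transition_le1 (h0 / 2) z y.
  rewrite /delta; case: (y == z) => /= ? ?; rewrite ler_norml; lra.
pose b t x := \int[P x]_w gen (delta z) (walk X t w).
have main (e1 : R) : 0 < e1 -> exists2 h0 : R, 0 < h0 & forall h, 0 < h < h0 ->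
    forall x t, 0 <= t ->
    `|(transition (t + h) z x - transition t z x) / h - b t x| <= e1.
  move=> e10; have [h0 h00 hb] := gi _ e10; exists h0 => // h hh x t t0.
  have hp : 0 <= h by case/andP: hh => /ltW.
  have -> : (transition (t + h) z x - transition t z x) / h =
      \int[P x]_w ((transition h z (walk X t w) - delta z (walk X t w)) / h).
    rewrite -(etr t h x t0 hp) -(eind t x t0) -RintegralB//; last 2 first.
    - by rewrite -(walkE X t0); exact: integrable_walk (tb h).
    - by rewrite -(walkE X t0); exact: integrable_walk ib.
    rewrite -RintegralZr//; first by rewrite (walkE X t0).
    rewrite -(walkE X t0); apply: (@integrable_walk _ (fun y => transition h z y - delta z y) 2) => y.
    by apply: le_trans (ler_normB _ _) _; have := tb h y; have := ib y; lra.
  have i1 : (P x).-integrable setT (EFin \o (fun w => (transition h z (walk X t w) - delta z (walk X t w)) / h)).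
    apply: (@integrable_walk _ (fun y => (transition h z y - delta z y) / h) (2 / h)) => y.
    rewrite normrM (ger0_norm (_ : 0 <= h^-1)) ?invr_ge0// ler_wpM2r ?invr_ge0//.
    by apply: le_trans (ler_normB _ _) _; have := tb h y; have := ib y; lra.
  have i2 : (P x).-integrable setT (EFin \o (fun w => gen (delta z) (walk X t w))).
    exact: integrable_walk gM.
  rewrite /b -RintegralB//.
  apply: le_trans (le_normr_Rintegral _ _) _ => //.
    by have := integrableB measurableT i1 i2; apply: eq_integrable.
  have -> : e1 = \int[P x]_w (cst e1 w).
    rewrite Rintegral_cst// -[LHS]mulr1; congr (_ * _).
    by rewrite -[LHS]/(fine 1%E); congr fine; exact/esym/probability_setT.
  apply: le_Rintegral => //.
  - apply: (@integrable_walk t (fun y => `|(transition h z y - delta z y) / h - gen (delta z) y|) e1) => y.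
    by rewrite normr_id; exact: hb.
  - apply: (@integrable_walk 0 (fun y => e1) `|e1|) => y //.
  - by move=> w _; exact: hb.
have bE t x : 0 <= t -> b t x = gen (transition t z) x.
  move=> t0; apply/eqP; rewrite -subr_eq0 -normr_le0; apply/ler_addgt0Pl => e1 e10.
  rewrite addr0; have e20 : 0 < e1 / 2 by rewrite divr_gt0.
  have [h0 h00 hb] := main _ e20.
  have := srw_generator srw (ex_intro _ 1 (tb t)) e20.
  rewrite near_withinE => /nbhs_ballP[h1 /= h10 hc].
  pose h := Num.min h0 h1 / 2.
  have m0 : 0 < Num.min h0 h1 by rewrite lt_min h00.
  have hp : 0 < h by rewrite /h; lra.
  have hh0 : h < h0.
    by apply: (@lt_le_trans _ _ (Num.min h0 h1)); rewrite ?ge_min ?lexx// /h; lra.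
  have hh1 : h < h1.
    by apply: (@lt_le_trans _ _ (Num.min h0 h1)); rewrite ?ge_min ?lexx ?orbT// /h; lra.
  have {}hc := hc h _ hp x.
  rewrite /ball/= sub0r normrN gtr0_norm// in hc; have {hc} := hc hh1.
  rewrite etr; [|exact: ltW|by []].
  have := hb h _ x t t0; rewrite hp hh0 => /(_ isT).
  rewrite (addrC h t) /gen.
  move: (_ / h) => q; rewrite !ler_norml => /andP[? ?] /andP[? ?]; lra.
move=> e0; have [h0 h00 hb] := main _ e0; exists h0 => // h hh x t t0.
by rewrite -bE//; exact: hb.
Qed.

End Transition.

(** * Kolmogorov's backward equation *)

Section Kolmogorov.
Context {R : realType} {d : nat} {disp : measure_display} {T : measurableType disp}.
Variables (kappa : R) (X : R -> T -> 'rV[int]_d) (P : 'rV[int]_d -> probability T R).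
Hypothesis srw : simple_random_walk kappa X P.
Notation Z := ('rV[int]_d).
Local Notation mu := (@lebesgue_measure R).
Local Notation p := (transition X P).
Let gen (f : Z -> R) x := kappa * laplacian f x.

Lemma transition_max t z x : p (Num.max 0 t) z x = p t z x.
Proof. by rewrite /transition /walk maxA maxxx. Qed.

Lemma gen_transition_bound t z x :
  `|gen (p t z) x| <= `|kappa| * (size (neighbours x))%:R.
Proof.
rewrite /gen normrM ler_wpM2l// laplacianE.
apply: le_trans (ler_norm_sum _ _ _) _.
apply: (@le_trans _ _ (\sum_(y <- neighbours x) 1)); last first.
  by rewrite big_const_seq count_predT iter_addr_0.
apply: ler_sum => y _.
have := transition_ge0 X P t z x; have := transition_ge0 X P t z y.
have := transition_le1 srw t z x; have := transition_le1 srw t z y.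
by move=> ? ? ? ?; rewrite ler_norml; lra.
Qed.

(** The difference quotients are bounded uniformly in time, so the transition
    probabilities are Lipschitz in time. *)
Lemma continuous_transition z x : continuous (fun t => p t z x).
Proof.
have [h0 h00 hb] := transition_gen srw z ltr01.
pose K := 1 + `|kappa| * (size (neighbours x))%:R.
have K0 : 0 < K by rewrite /K ltr_pwDl// mulr_ge0.
have lip s t : 0 <= s -> s <= t -> t - s < h0 -> `|p t z x - p s z x| <= K * (t - s).
  move=> s0; rewrite le_eqVlt => /predU1P[->|st ts].
    by rewrite !subrr normr0 mulr0.
  have ts0 : 0 < t - s by rewrite subr_gt0.
  have := hb (t - s); rewrite ts0 ts => /(_ isT x s s0).
  rewrite subrKC => hq; have := gen_transition_bound s z x.
  move=> hg; rewrite -ler_pdivrMr//.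
  rewrite -[X in _ / X](gtr0_norm ts0) -normf_div.
  move: hq hg; rewrite /K -/(gen _ _); move: (_ / _) (gen _ _) => a b hq hg.
  by have := ler_normD (a - b) b; rewrite subrK; lra.
have lip' s t : 0 <= s -> 0 <= t -> `|t - s| < h0 ->
    `|p t z x - p s z x| <= K * `|t - s|.
  move=> s0 t0; have [st|/ltW ts] := leP s t.
    rewrite (ger0_norm (_ : 0 <= t - s)) ?subr_ge0//; exact: lip.
  rewrite distrC [X in _ -> X <= _]distrC (ger0_norm (_ : 0 <= s - t)) ?subr_ge0//.
  exact: lip.
move=> t; apply/cvgrPdist_le => e e0 /=.
near=> s; rewrite -(transition_max t) -(transition_max s).
have ms : `|Num.max 0 t - Num.max 0 s| <= `|t - s|.
  rewrite /Num.max; case: ltP => ?; case: ltP => ?; rewrite ?subrr ?normr0//.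
  - by rewrite subr0 !ger0_norm; lra.
  - by rewrite sub0r normrN distrC !ger0_norm; lra.
have tsh : `|t - s| < h0 by near: s; exact: cvgr_dist_lt.
apply: le_trans (lip' _ _ _ _ _) _; rewrite ?le_max ?lexx//.
  exact: le_lt_trans tsh.
rewrite -ler_pdivlMl//; apply: le_trans ms _.
near: s; apply: cvgr_dist_le => //; rewrite mulr_gt0// invr_gt0//.
Unshelve. all: by end_near. Qed.

Lemma continuous_gen_transition z x : continuous (fun t => gen (p t z) x).
Proof.
have C s : continuous (fun t => \sum_(y <- s) (p t z y - p t z x)).
  elim: s => [|y s IH].
    rewrite (_ : (fun _ => _) = cst 0); first exact: cst_continuous.
    by apply/funext => t; rewrite big_nil.
  rewrite (_ : (fun _ => _) =
      (fun t => (p t z y - p t z x) + \sum_(y <- s) (p t z y - p t z x))).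
    move=> t; apply: cvgD; last exact: IH.
    by apply: cvgB; exact: continuous_transition.
  by apply/funext => t; rewrite big_cons.
rewrite (_ : (fun _ => _) =
    (fun t => kappa * \sum_(y <- neighbours x) (p t z y - p t z x))).
  by move=> t; apply: cvgMl_tmp; exact: C.
by apply/funext => t; rewrite /gen laplacianE.
Qed.

(** The estimate on right quotients, taken at the base point t + h with h < 0,
    controls the left quotient at t; continuity of the generator term then
    replaces t + h by t. *)
Lemma is_derive_transition (z x : Z) (t : R) : 0 < t ->
  is_derive t 1 (fun s : R => p s z x) (gen (p t z) x).
Proof.
move=> t0.
have C : h^-1 *: (((fun s => p s z x) \o shift t) (h *: 1) - p t z x)
    @[h --> 0^'] --> gen (p t z) x.
  apply/cvgrPdist_le => /= e e0.
  have e20 : 0 < e / 2 by rewrite divr_gt0.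
  have [h0 h00 hb] := transition_gen srw z e20.
  have : \forall s \near t, `|gen (p t z) x - gen (p s z) x| <= e / 2.
    by have /cvgrPdist_le/(_ _ e20) := @continuous_gen_transition z x t.
  move=> /nbhs_ballP[d0 /= d00 hd].
  have m0 : 0 < Num.min (Num.min h0 d0) t by rewrite !lt_min h00 d00.
  near=> h.
  have h_neq0 : h != 0 by near: h; exact: nbhs_dnbhs_neq.
  have : `|h| < Num.min (Num.min h0 d0) t.
    by near: h; apply: dnbhs0_lt.
  rewrite !lt_min -andbA => /and3P[hh0 hd0 ht].
  rewrite /shift/= scaler1 /GRing.scale/= mulrC (addrC h).
  have [hp|hn] := ltP 0 h.
    rewrite distrC; apply: (@le_trans _ _ (e / 2)); last lra.
    apply: hb; last exact: ltW.
    by rewrite hp/= -(gtr0_norm hp).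
  have {}hn : h < 0 by rewrite lt_neqAle h_neq0.
  rewrite ltr0_norm// in hh0 hd0 ht.
  have th0 : 0 <= t + h by lra.
  have := hb (- h) _ x (t + h) th0; rewrite oppr_gt0 hn hh0 => /(_ isT).
  rewrite addrK.
  have -> : (p t z x - p (t + h) z x) / - h = (p (t + h) z x - p t z x) / h.
    by rewrite invrN mulrN -mulNr opprB.
  have : `|gen (p t z) x - gen (p (t + h) z) x| <= e / 2.
    by apply: hd; rewrite /ball/= opprD addrA subrr sub0r normrN ltr0_norm.
  rewrite -/(gen _ _); move: (_ / h) (gen _ _) (gen _ _) => a b c.
  by rewrite !ler_norml => /andP[? ?] /andP[? ?]; lra.
apply: DeriveDef; first by apply/cvg_ex; exists (gen (p t z) x).
by apply/cvg_lim.
Unshelve. all: by end_near. Qed.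

Let weighted (c r : R) z x (s : R) := expR (c * (s - r)) * p (s - r) z x.

Let continuous_shift (f : R -> R) r : continuous f -> continuous (fun s => f (s - r)).
Proof.
move=> cf s; apply: continuous_comp; last exact: cf.
by apply: cvgB; [exact: cvg_id|exact: cvg_cst].
Qed.

Let continuous_weight c r : continuous (fun s : R => expR (c * (s - r))).
Proof.
apply: (@continuous_shift (fun s => expR (c * s))) => s.
apply: continuous_comp; last exact: continuous_expR.
by apply: cvgMl_tmp; exact: cvg_id.
Qed.

Let continuous_weighted c r z x : continuous (weighted c r z x).
Proof.
move=> s; apply: cvgM; first exact: continuous_weight.
by apply: (@continuous_shift (fun s => p s z x)); exact: continuous_transition.
Qed.

(** Kolmogorov's backward equation in integrated form, with an exponential
    weight that serves both for killing (negative rate) and for compensating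
    the jump rate. *)
Lemma kolmogorov_backward z x (c r a b : R) : r <= a -> a <= b ->
  (\int[mu]_(s in `[a, b]) (expR (c * (s - r)) *
      (c * p (s - r) z x + gen (p (s - r) z) x))%:E)%E =
  (weighted c r z x b - weighted c r z x a)%:E.
Proof.
move=> ra; rewrite le_eqVlt => /predU1P[<-|ab].
  by rewrite set_itv1 integral_set1 subrr.
have D s : s \in `]a, b[ -> is_derive s 1 (weighted c r z x)
    (expR (c * (s - r)) * (c * p (s - r) z x + gen (p (s - r) z) x)).
  rewrite in_itv/= => /andP[as_ sb].
  have d1 : is_derive s 1 (fun s : R => s - r) 1.
    by have := is_deriveB (is_derive_id s (1 : R)) (is_derive_cst r s 1); rewrite subr0.
  have sr0 : 0 < s - r by lra.
  have d2 : is_derive s 1 (fun s => p (s - r) z x) (gen (p (s - r) z) x).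
    by have := @is_derive1_comp _ (fun s => p s z x) (fun s => s - r) s _ _ (is_derive_transition z x sr0) d1; rewrite mulr1.
  have d3 : is_derive s 1 (fun s => expR (c * (s - r))) (expR (c * (s - r)) * c).
    have d4 : is_derive s 1 (fun s => c * (s - r)) c.
      by have := @is_deriveZ _ _ _ (fun s : R => s - r) c s 1 1 d1; rewrite scaler1.
    exact: (@is_derive1_comp _ expR (fun s => c * (s - r)) s _ _ (is_derive_expR _) d4).
  apply: is_derive_eq (is_deriveM d3 d2) _.
  by rewrite /GRing.scale/=; ring.
rewrite (@continuous_FTC2 _ _ (weighted c r z x) a b ab)//.
- apply: continuous_subspaceT => s; apply: cvgM; first exact: continuous_weight.
  apply: cvgD.
    apply: cvgMl_tmp; apply: (@continuous_shift (fun s => p s z x)).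
    exact: continuous_transition.
  by apply: (@continuous_shift (fun s => gen (p s z) x)); exact: continuous_gen_transition.
- split=> [s /D [] //||].
  - exact/cvg_at_right_filter/continuous_weighted.
  - exact/cvg_at_left_filter/continuous_weighted.
- by move=> s sab; rewrite derive1E; case: (D s sab).
Qed.

Definition jump_rate (x : Z) : R := kappa * (size (neighbours x))%:R.

(** With the jump rate as exponent the loss term of the backward equation
    cancels, and the gain term is nonnegative. *)
Lemma transition_weight_ndecr z x (a b : R) : 0 <= kappa -> 0 <= a -> a <= b ->
  expR (jump_rate x * a) * p a z x <= expR (jump_rate x * b) * p b z x.
Proof.
move=> k0 a0 ab; rewrite -subr_ge0 -lee_fin.
have := kolmogorov_backward z x (jump_rate x) a0 ab.
rewrite /weighted !subr0 => <-; apply: integral_ge0 => s _.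
rewrite lee_fin mulr_ge0 ?expR_ge0// /gen laplacian_gain_loss mulrBr /jump_rate.
rewrite -mulrA subrKC mulr_ge0//; apply: sumr_ge0 => y _; exact: transition_ge0.
Qed.

Local Open Scope ereal_scope.

(** The semigroup of the walk killed at rate C, written as a sum over the end
    point z because its renewal identity is proved for each z separately. *)
Definition killed_semigroup (C t : R) (f : Z -> \bar R) (x : Z) : \bar R :=
  csum (fun z => f z * (expR (- C * t) * p t z x)%:E).

Lemma killed_semigroupE C t f x : (forall z, 0 <= f z) ->
  killed_semigroup C t f x = (expR (- C * t))%:E * semigroup X P t f x.
Proof.
move=> f0; rewrite (semigroupE srw)// -csumZl; last by move=> z; rewrite mule_ge0.
by apply: eq_csum => z; rewrite (transitionE srw) EFinM muleCA.
Qed.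

Let integrable_weighted c r z x a b :
  mu.-integrable `[a, b] (EFin \o weighted c r z x).
Proof.
apply: continuous_compact_integrable; first exact: segment_compact.
by apply: continuous_subspaceT; exact: continuous_weighted.
Qed.

Let weighted_ge0 c r z x s : (0 <= weighted c r z x s)%R.
Proof. by rewrite mulr_ge0 ?expR_ge0 ?transition_ge0. Qed.

Let measurable_weighted c r z x : measurable_fun setT (weighted c r z x).
Proof. by apply: continuous_measurable_fun; exact: continuous_weighted. Qed.

(** The integrated backward equation with the loss and killing terms moved to
    the left, so that no subtraction remains. *)
Let killed_transition_eq C r t z x : (0 <= kappa)%R -> (0 <= C)%R -> (r <= t)%R ->
  (weighted (- C) r z x t)%:E +
    (jump_rate x + C)%:E * \int[mu]_(s in `[r, t]) (weighted (- C) r z x s)%:E =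
  (delta z x : R)%:E + kappa%:E *
    \sum_(y <- neighbours x) \int[mu]_(s in `[r, t]) (weighted (- C) r z y s)%:E.
Proof.
move=> k0 C0 rt; have := kolmogorov_backward z x (- C) (lexx r) rt.
have w0 : weighted (- C) r z x r = (delta z x : R).
  by rewrite /weighted subrr mulr0 expR0 mul1r (transition0 srw).
rewrite w0.
have iw y : mu.-integrable `[r, t] (EFin \o weighted (- C) r z y).
  exact: integrable_weighted.
pose g1 s := ((jump_rate x + C) * weighted (- C) r z x s)%R.
pose g2 s := (kappa * \sum_(y <- neighbours x) weighted (- C) r z y s)%R.
have i1 : mu.-integrable `[r, t] (EFin \o g1).
  by apply: eq_integrable (integrableZl _ (jump_rate x + C) (iw x)).
have i2 : mu.-integrable `[r, t] (EFin \o g2).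
  have i3 : mu.-integrable `[r, t] (fun s => \sum_(y <- neighbours x) (weighted (- C) r z y s)%:E).
    by apply: integrable_sum => // y _; exact: iw.
  apply: eq_integrable (integrableZl _ kappa i3) => // s _.
  by rewrite /= /g2 EFinM sumEFin.
have -> : \int[mu]_(s in `[r, t]) (expR (- C * (s - r)) *
      (- C * p (s - r) z x + gen (p (s - r) z) x))%:E =
    \int[mu]_(s in `[r, t]) ((g2 s - g1 s)%R)%:E.
  apply: eq_integral => s _; congr EFin.
  rewrite /gen laplacian_gain_loss /g1 /g2 /weighted /jump_rate -mulr_sumr; ring.
rewrite integralB_EFin//.
have E1 : \int[mu]_(s in `[r, t]) (g1 s)%:E =
   (jump_rate x + C)%:E * \int[mu]_(s in `[r, t]) (weighted (- C) r z x s)%:E.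
  by rewrite -integralZl//; [exact: iw].
have E2 : \int[mu]_(s in `[r, t]) (g2 s)%:E = kappa%:E *
    \sum_(y <- neighbours x) \int[mu]_(s in `[r, t]) (weighted (- C) r z y s)%:E.
  rewrite -ge0_integral_sum//; last 2 first.
  - by move=> y; apply: measurable_funTS; apply/measurable_EFinP; exact: measurable_weighted.
  - by move=> y s _; rewrite lee_fin weighted_ge0.
  rewrite -ge0_integralZl//; last 2 first.
  - by apply: measurable_funTS; apply: emeasurable_sum => y; apply/measurable_EFinP; exact: measurable_weighted.
  - by move=> s _; apply: sume_ge0 => y _; rewrite lee_fin weighted_ge0.
  by apply: eq_integral => s _; rewrite /g2 EFinM sumEFin.
have f1 : \int[mu]_(s in `[r, t]) (g1 s)%:E \is a fin_num by exact: integrable_fin_num i1.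
have f2 : \int[mu]_(s in `[r, t]) (g2 s)%:E \is a fin_num by exact: integrable_fin_num i2.
rewrite -E1 -E2 -(fineK f1) -(fineK f2) -EFinB => -[h].
by rewrite -!EFinD; congr EFin; rewrite -[LHS]addrC -[RHS]addrC; move: h; lra.
Qed.

Let measurable_scaled_weighted (f : Z -> \bar R) c r z y D :
  measurable_fun D (fun s => f z * (weighted c r z y s)%:E).
Proof.
apply: measurable_funTS; apply: emeasurable_funM; first exact: measurable_cst.
by apply/measurable_EFinP; exact: measurable_weighted.
Qed.

Let integral_weighted_ge0 c r t z y :
  0 <= \int[mu]_(s in `[r, t]) (weighted c r z y s)%:E.
Proof. by apply: integral_ge0 => s _; rewrite lee_fin weighted_ge0. Qed.

Let integral_killed C r t f y : (forall z, 0 <= f z) ->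
  \int[mu]_(s in `[r, t]) killed_semigroup C (s - r)%R f y =
  csum (fun z => f z * \int[mu]_(s in `[r, t]) (weighted (- C) r z y s)%:E).
Proof.
move=> f0.
have fw0 z s : `[r, t]%classic s -> 0 <= f z * (weighted (- C) r z y s)%:E.
  by move=> _; rewrite mule_ge0// lee_fin weighted_ge0.
have mI : measurable (`[r, t]%classic : set (measurableTypeR R)) by [].
transitivity (csum (fun z => \int[mu]_(s in `[r, t]) (f z * (weighted (- C) r z y s)%:E))).
  have mF z : measurable_fun (`[r, t]%classic : set (measurableTypeR R)) (fun s => f z * (weighted (- C) r z y s)%:E).
    exact: measurable_scaled_weighted.
  by rewrite -(integral_csum mu mI mF fw0).
apply: eq_csum => z; rewrite ge0_integralZl//.
  by apply: measurable_funTS; apply/measurable_EFinP; exact: measurable_weighted.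
by move=> s _; rewrite lee_fin weighted_ge0.
Qed.

Let killed_csum C r t f x :
  killed_semigroup C (t - r)%R f x = csum (fun z => f z * (weighted (- C) r z x t)%:E).
Proof. by []. Qed.

Opaque killed_semigroup.

(** As all terms are nonnegative, the identity for each end point can be
    summed against an arbitrary nonnegative f; both sides may be infinite. *)
Lemma killed_semigroup_renewal C r t f x : (0 <= kappa)%R -> (0 <= C)%R -> (r <= t)%R ->
  (forall z, 0 <= f z) ->
  killed_semigroup C (t - r)%R f x +
    (jump_rate x + C)%:E * \int[mu]_(s in `[r, t]) killed_semigroup C (s - r)%R f x =
  f x + kappa%:E *
    \sum_(y <- neighbours x) \int[mu]_(s in `[r, t]) killed_semigroup C (s - r)%R f y.
Proof.
move=> k0 C0 rt f0.
have iw0 z y := integral_weighted_ge0 (- C) r t z y.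
have iK y := integral_killed C r t y f0.
have j0 : (0 <= jump_rate x + C)%R by rewrite addr_ge0// mulr_ge0.
rewrite [X in X + _ = _](killed_csum C r t f x).
rewrite [X in _ + _ * X = _](iK x).
have fI0 y z : 0 <= f z * \int[mu]_(s in `[r, t]) (weighted (- C) r z y s)%:E.
  exact: (mule_ge0 (f0 z) (iw0 z y)).
rewrite -(csumZl _ (fI0 x)).
rewrite -csumD; last 2 first.
- by move=> z; rewrite mule_ge0// lee_fin; exact: (weighted_ge0 (- C) r z x t).
- by move=> z; rewrite !mule_ge0.
under [in RHS]eq_bigr do rewrite iK.
rewrite -csum_sum; last by move=> y z; rewrite mule_ge0.
rewrite -csumZl; last by move=> z; apply: sume_ge0 => y _; rewrite mule_ge0.
have -> : f x = csum (fun z => f z * (delta z x : R)%:E).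
  rewrite (csum_single (i0 := x)) => [|z|z zx].
  - by rewrite /delta eqxx mule1.
  - by rewrite mule_ge0// lee_fin ler0n.
  - by rewrite /delta eq_sym (negbTE zx) mule0.
rewrite -csumD; last 2 first.
- by move=> z; rewrite mule_ge0// lee_fin ler0n.
- by move=> z; rewrite mule_ge0//; apply: sume_ge0 => y _; rewrite mule_ge0.
apply: eq_csum => z.
rewrite muleCA -ge0_muleDr//; last 2 first.
- by rewrite lee_fin; exact: (weighted_ge0 (- C) r z x t).
- by rewrite mule_ge0.
rewrite (killed_transition_eq z x k0 C0 rt) ge0_muleDr ?lee_fin ?ler0n//; last first.
  by rewrite mule_ge0//; apply: sume_ge0.
by congr (_ + _); rewrite muleCA ge0_sume_distrr.
Qed.

End Kolmogorov.
Global Opaque killed_semigroup.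

(** * The Dyson series *)

Section Dyson.
Context {R : realType} {d : nat} {disp : measure_display} {T : measurableType disp}.
Variables (kappa : R) (X : R -> T -> 'rV[int]_d) (P : 'rV[int]_d -> probability T R).
Hypothesis srw : simple_random_walk kappa X P.
Notation Z := ('rV[int]_d).
Local Notation mu := (@lebesgue_measure R).
Local Open Scope ereal_scope.

Variables (W : Z -> R -> \bar R) (u0 : Z -> \bar R).
Hypotheses (mW : forall z, measurable_fun setT (W z)).
Hypotheses (W0 : forall z r, 0 <= W z r) (u00 : forall z, 0 <= u0 z).

Lemma measurable_semigroup d1 (S : measurableType d1) (a : S -> R)
    (f : Z -> S -> \bar R) x :
  measurable_fun setT a -> (forall z, measurable_fun setT (f z)) ->
  (forall z s, 0 <= f z s) ->
  measurable_fun setT (fun s => semigroup X P (a s) (f^~ s) x).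
Proof.
move=> ma mf f0.
apply: (@measurable_integral2 _ _ _ _ _ (P x) (fun q => f (walk X (a q.1) q.2) q.1)) => //.
apply: (measurable_along_walk srw (a := fun q => a q.1) (b := snd) (f := fun z q => f z q.1)) => //.
  exact: measurableT_comp.
by move=> z; exact: measurableT_comp.
Qed.

(** The term of the Dyson series with n interactions. The variable r is the
    time of the potential; since the formula runs the walk against that time,
    the walk is then at its own time t - r. *)
Fixpoint dyson n (x : Z) (t : R) : \bar R :=
  if n is n'.+1 then
    \int[mu]_(r in `[0%R, t])
      semigroup X P (t - r) (fun z => W z r * dyson n' z r) x
  else semigroup X P t u0 x.

Lemma dyson_ge0 n x t : 0 <= dyson n x t.
Proof.
elim: n x t => [|n IH] x t /=; first exact: semigroup_ge0.
by apply: integral_ge0 => r _; apply: semigroup_ge0 => z; exact: mule_ge0.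
Qed.

Lemma measurable_dyson n x : measurable_fun setT (dyson n x).
Proof.
elim: n x => [|n IH] x /=.
  by apply: (@measurable_semigroup _ _ id (fun z _ => u0 z)) => //.
apply: (@measurable_integral_0x _ _ _ id
  (fun q => semigroup X P (q.1 - q.2) (fun z => W z q.2 * dyson n z q.2) x)) => //.
  apply: (@measurable_semigroup _ _ (fun q : R * R => (q.1 - q.2)%R)
    (fun z q => W z q.2 * dyson n z q.2)).
  - exact: measurable_funB.
  - move=> z; apply: emeasurable_funM; first exact: measurableT_comp.
    exact: measurableT_comp.
  - by move=> z q; rewrite mule_ge0// dyson_ge0.
move=> q; apply: semigroup_ge0 => z.
by rewrite mule_ge0// dyson_ge0.
Qed.

(** The potential seen, at field time r, by the walk run backwards from time t. *)
Definition path_potential (t : R) (w : T) (r : R) : \bar R := W (walk X (t - r) w) r.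

Let pathI t w n r := iter_integral (path_potential t w) n r.

Lemma measurable_path_potential2 t :
  measurable_fun setT (fun q : T * R => path_potential t q.1 q.2).
Proof.
apply: (measurable_along_walk srw (a := fun q : T * R => (t - q.2)%R) (b := fst)
  (f := fun z q => W z q.2)) => //.
  by apply: measurable_funB => //; exact: measurable_cst.
by move=> z; exact: measurableT_comp.
Qed.

Lemma measurable_path_potential t w : measurable_fun setT (path_potential t w).
Proof.
apply: (@measurableT_comp _ _ _ _ _ _ _ _ (pair w) (measurable_path_potential2 t)).
exact: pair1_measurable.
Qed.

Let measurable_pathI t n : measurable_fun setT (fun q : T * R => pathI t q.1 n q.2).
Proof.
rewrite /pathI; elim: n => [|n IH] /=; first exact: measurable_cst.
have mp : measurable_fun setT (fun q : (T * R) * R => (q.1.1, q.2)).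
  apply: measurable_fun_pair => //.
  exact: (@measurableT_comp _ _ _ _ _ _ fst _ fst).
apply: (@measurable_integral_0x _ _ _ snd (fun q : (T * R) * R =>
   path_potential t q.1.1 q.2 * iter_integral (path_potential t q.1.1) n q.2)) => //.
  apply: emeasurable_funM.
    exact: (@measurableT_comp _ _ _ _ _ _ _ _ _ (measurable_path_potential2 t) mp).
  exact: (@measurableT_comp _ _ _ _ _ _ _ _ _ IH mp).
move=> q; apply: mule_ge0; first exact: W0.
by apply: iter_integral_ge0 => r; exact: W0.
Qed.

Let pathI_ge0 t w n r : 0 <= pathI t w n r.
Proof. by apply: iter_integral_ge0 => s; exact: W0. Qed.

Let measurable_pathI1 t n r : measurable_fun setT (fun w => pathI t w n r).
Proof.
exact: (@measurableT_comp _ _ _ _ _ _ _ _ (fun w => (w, r)) (measurable_pathI t n)).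
Qed.

Let measurable_end t : measurable_fun setT (fun w => u0 (walk X t w)).
Proof.
by apply: (measurable_along_walk srw (a := fun=> t) (b := id) (f := fun z _ => u0 z)).
Qed.

(** Given the path up to walk time t - tau, the mean of the part of the
    Feynman-Kac functional with n interactions at potential times below tau is
    the Dyson term at the current site. The event A is what the induction
    needs: the first interaction, at potential time r, happens at walk time t
    - r; the induction hypothesis applies to the events on which A holds and
    the walk is then at a given site, and the Markov property between the walk
    times t - tau and t - r does the rest. *)
Lemma dyson_markov n t tau A x : (0 <= tau <= t)%R -> past X (t - tau) A ->
  \int[P x]_(w in A) (pathI t w n tau * u0 (walk X t w)) =
  \int[P x]_(w in A) dyson n (walk X (t - tau) w) tau.
Proof.
elim: n t tau A => [|n IH] t tau A /andP[tau0 taut] pA.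
  under eq_integral do rewrite mul1e.
  have tt : (0 <= t - tau)%R by rewrite subr_ge0.
  have := markov_semigroup srw x tt tau0 pA u00.
  by rewrite subrK.
have tt : (0 <= t - tau)%R by rewrite subr_ge0.
have mA : measurable A := past_measurable srw tt pA.
pose h r z := W z r * dyson n z r.
have h0 r z : 0 <= h r z by rewrite mule_ge0// dyson_ge0.
pose F (q : T * R) := path_potential t q.1 q.2 * pathI t q.1 n q.2 * u0 (walk X t q.1).
have F0 q : 0 <= F q.
  by apply: mule_ge0 => //; apply: mule_ge0; [exact: W0|exact: pathI_ge0].
have mF : measurable_fun setT F.
  apply: emeasurable_funM; last first.
    exact: (@measurableT_comp _ _ _ _ _ _ _ _ fst (measurable_end t)).
  by apply: emeasurable_funM; [exact: measurable_path_potential2|exact: measurable_pathI].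
have mtau : measurable (`[0%R, tau]%classic : set (measurableTypeR R)) by [].
transitivity (\int[P x]_(w in A) \int[mu]_(r in `[0%R, tau]) F (w, r)).
  apply: eq_integral => w _; rewrite /pathI/= -ge0_integralZr//.
  - apply: measurable_funTS; apply: emeasurable_funM.
      exact: measurable_path_potential.
    apply: measurable_iter_integral; last by move=> r; exact: W0.
    exact: measurable_path_potential.
  - by move=> r _; apply: mule_ge0; [exact: W0|exact: pathI_ge0].
rewrite (tonelli_dom (P x) mu mA mtau mF F0).
pose G (q : T * R) := semigroup X P (tau - q.2) (h q.2) (walk X (t - tau) q.1).
transitivity (\int[mu]_(r in `[0%R, tau]) \int[P x]_(w in A) G (w, r)).
  apply: eq_integral => r; rewrite inE/= in_itv/= => /andP[r0 rtau].
  have rt : (r <= t)%R := le_trans rtau taut.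
  have tr0 : (0 <= t - r)%R by rewrite subr_ge0.
  have ttr : (t - tau <= t - r)%R by rewrite lerD2l lerN2.
  have tr : (0 <= tau - r)%R by rewrite subr_ge0.
  have mwk z : measurable (walk X (t - r) @^-1` [set z]) by exact: (measurable_walk srw).
  have pAr z : past X (t - r) (A `&` walk X (t - r) @^-1` [set z]).
    apply: past_setI; first exact: sub_past pA.
    by apply: past_walk; rewrite tr0 lexx.
  transitivity (\int[P x]_(w in A) h r (walk X (t - r) w)).
    have mF1 : measurable_fun A (fun w => F (w, r)).
      apply: measurable_funTS.
      exact: (@measurableT_comp _ _ _ _ _ _ _ _ (fun w => (w, r)) mF).
    have mh1 : measurable_fun A (fun w => h r (walk X (t - r) w)).
      apply: measurable_funTS.
      by apply: (measurable_along_walk srw (a := fun=> (t - r)%R) (b := id) (f := fun z _ => h r z)).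
    rewrite (ge0_integral_fibres (P x) mwk mA mF1 (fun w _ => F0 _)).
    rewrite (ge0_integral_fibres (P x) mwk mA mh1 (fun w _ => h0 _ _)).
    apply: eq_csum => z.
    have mAz : measurable (A `&` walk X (t - r) @^-1` [set z]) by exact: measurableI.
    transitivity (W z r * \int[P x]_(w in A `&` walk X (t - r) @^-1` [set z])
        (pathI t w n r * u0 (walk X t w))).
      rewrite -ge0_integralZl//.
      - by apply: eq_integral => w; rewrite inE => -[_ /= zE]; rewrite /F/= -muleA /path_potential zE.
      - apply: measurable_funTS; apply: emeasurable_funM => //; exact: measurable_pathI1.
      - by move=> w _; apply: mule_ge0; [exact: pathI_ge0|exact: u00].
    rewrite IH ?r0//.
    rewrite -ge0_integralZl//.
    - by apply: eq_integral => w; rewrite inE => -[_ /= zE]; rewrite /h zE.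
    - apply: measurable_funTS.
      by apply: (measurable_along_walk srw (a := fun=> (t - r)%R) (b := id) (f := fun z _ => dyson n z r)).
    - by move=> w _; exact: dyson_ge0.
  have := markov_semigroup srw x tt tr pA (h0 r).
  by rewrite addrA subrK => ->.
have G0 q : 0 <= G q by exact: semigroup_ge0.
have mG : measurable_fun setT G.
  rewrite /G; apply: (measurable_along_walk srw (a := fun _ : T * R => (t - tau)%R) (b := fst)
    (f := fun y (q : T * R) => semigroup X P (tau - q.2) (h q.2) y)) => // y.
  apply: (@measurable_semigroup _ _ (fun q : T * R => (tau - q.2)%R) (fun z q => h q.2 z)) => //.
    by apply: measurable_funB => //; exact: measurable_cst.
  move=> z; apply: emeasurable_funM; first exact: measurableT_comp.
  by apply: (measurableT_comp (measurable_dyson n z)).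
by rewrite -(tonelli_dom (P x) mu mA mtau mG G0).
Qed.

(** The exponential is expanded into iterated integrals, and the previous
    lemma is used with tau = t and the sure event. *)
Lemma feynman_kac_dyson x t : (0 <= t)%R -> (forall z, u0 z \is a fin_num) ->
  (forall w, \int[mu]_(r in `[0%R, t]) path_potential t w r < +oo) ->
  \int[P x]_w ((expR (fine (\int[mu]_(r in `[0%R, t]) path_potential t w r)))%:E
     * u0 (walk X t w)) =
  \sum_(n <oo) dyson n x t.
Proof.
move=> t0 u0fin fin.
transitivity (\int[P x]_w \sum_(n <oo) (pathI t w n t * u0 (walk X t w))).
  apply: eq_integral => w _; rewrite exp_integral//.
  - rewrite muleC; under [in RHS]eq_eseriesr do rewrite muleC.
    case: (u0 (walk X t w)) (u0fin (walk X t w)) => [a| |] // _.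
    by rewrite nneseriesZl// => i _; exact: pathI_ge0.
  - exact: measurable_path_potential.
  - by move=> r; exact: W0.
have mF n : measurable_fun setT (fun w => pathI t w n t * u0 (walk X t w)).
  by apply: emeasurable_funM => //; exact: measurable_pathI1.
have F0 : forall n w, [set: T] w -> 0 <= pathI t w n t * u0 (walk X t w).
  by move=> n v _; apply: mule_ge0; [exact: pathI_ge0|exact: u00].
rewrite (integral_nneseries (P x) measurableT mF F0).
apply: eq_eseriesr => n _.
have := @dyson_markov n t t setT x; rewrite t0 lexx => /(_ isT); rewrite subrr.
move=> -> //; last exact: pastT.
have := semigroup0 srw x (fun z => dyson_ge0 n z t).
by rewrite /semigroup.
Qed.

End Dyson.

(** * The renewal identity of the Dyson series *)

Lemma measurable_EFin_exp {R : realType} d (S : measurableType d) (f : S -> R) :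
  measurable_fun setT f -> measurable_fun setT (fun s => (expR (f s))%:E).
Proof. by move=> mf; apply/measurable_EFinP; exact: measurableT_comp. Qed.

Section Renewal.
Context {R : realType} {d : nat} {disp : measure_display} {T : measurableType disp}.
Variables (kappa : R) (X : R -> T -> 'rV[int]_d) (P : 'rV[int]_d -> probability T R).
Hypothesis srw : simple_random_walk kappa X P.
Hypothesis kappa_ge0 : 0 <= kappa.
Notation Z := ('rV[int]_d).
Local Notation mu := (@lebesgue_measure R).
Local Open Scope ereal_scope.

Lemma semigroup_weight_ndecr f x (a b : R) : (forall z, 0 <= f z) ->
  (0 <= a)%R -> (a <= b)%R ->
  (expR (jump_rate kappa x * a))%:E * semigroup X P a f x <=
  (expR (jump_rate kappa x * b))%:E * semigroup X P b f x.
Proof.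
move=> f0 a0 ab; set j := jump_rate kappa x.
have E c : (expR (j * c))%:E * semigroup X P c f x =
    csum (fun z => f z * (expR (j * c) * transition X P c z x)%:E).
  rewrite (semigroupE srw _ _ f0) -csumZl; last first.
    by move=> z; exact: mule_ge0.
  by apply: eq_csum => z; rewrite (transitionE srw) EFinM muleCA.
rewrite !E; apply: le_csum => z.
  by apply: mule_ge0 => //; rewrite lee_fin mulr_ge0 ?expR_ge0 ?transition_ge0.
by apply: lee_wpmul2l => //; rewrite lee_fin; exact: (transition_weight_ndecr srw).
Qed.

Variables (W : Z -> R -> \bar R) (u0 : Z -> \bar R).
Hypotheses (mW : forall z, measurable_fun setT (W z)).
Hypotheses (W0 : forall z r, 0 <= W z r) (u00 : forall z, 0 <= u0 z).
Local Notation D := (dyson X P W u0).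

Let D0 n x t : 0 <= D n x t. Proof. exact: dyson_ge0. Qed.
Let mD n x : measurable_fun setT (D n x). Proof. exact: (measurable_dyson srw). Qed.
Let WD0 n z r : 0 <= W z r * D n z r. Proof. exact: mule_ge0. Qed.

Let measurable_semigroup_dyson n x (t : R) :
  measurable_fun setT (fun r : R => semigroup X P (t - r)%R (fun z => W z r * D n z r) x).
Proof.
apply: (@measurable_semigroup _ _ _ _ _ _ _ srw _ _ (fun r : R => (t - r)%R)
   (fun z r => W z r * D n z r)) => //.
  by apply: measurable_funB => //; exact: measurable_cst.
by move=> z; exact: emeasurable_funM.
Qed.

(** The weight factors into a part for time r, which does not depend on t, and
    a part for time t - r, for which the weighted semigroup is nondecreasing;
    a larger t also enlarges the domain of integration. *)
Lemma dyson_weight_ndecr n x (a b : R) : (0 <= a)%R -> (a <= b)%R ->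
  (expR (jump_rate kappa x * a))%:E * D n x a <=
  (expR (jump_rate kappa x * b))%:E * D n x b.
Proof.
move=> a0 ab; case: n => [|n]; first exact: semigroup_weight_ndecr.
set j := jump_rate kappa x.
pose h r z := W z r * D n z r.
pose G t r := (expR (j * r))%:E * ((expR (j * (t - r)))%:E * semigroup X P (t - r) (h r) x).
have h0 r z : 0 <= h r z by exact: WD0.
have G0 t r : 0 <= G t r.
  by rewrite /G !mule_ge0 ?lee_fin ?expR_ge0//; exact: semigroup_ge0.
have mG t : measurable_fun setT (G t).
  apply: emeasurable_funM.
    apply: measurable_EFin_exp.
    by apply: measurable_funM => //; exact: measurable_cst.
  apply: emeasurable_funM; last exact: measurable_semigroup_dyson.
  apply: measurable_EFin_exp.
  apply: measurable_funM; first exact: measurable_cst.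
  by apply: measurable_funB => //; exact: measurable_cst.
have E t : (expR (j * t))%:E * D n.+1 x t = \int[mu]_(r in `[0%R, t]) G t r.
  rewrite /= -ge0_integralZl//; last 2 first.
  - by apply: measurable_funTS; exact: measurable_semigroup_dyson.
  - by move=> r _; exact: semigroup_ge0.
  by apply: eq_integral => r _; rewrite /G muleA -EFinM -expRD -mulrDr subrKC.
rewrite !E; apply: (@le_trans _ _ (\int[mu]_(r in `[0%R, a]) G b r)).
  apply: ge0_le_integral => //.
  - by apply: measurable_funTS; exact: mG.
  - by apply: measurable_funTS; exact: mG.
  move=> r; rewrite /= in_itv/= => /andP[r0 ra].
  apply: lee_wpmul2l; first by rewrite lee_fin expR_ge0.
  by apply: semigroup_weight_ndecr => //; lra.
apply: ge0_subset_integral => //; first by apply: measurable_funTS; exact: mG.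
by move=> r /=; rewrite !in_itv/= => /andP[-> /le_trans]; exact.
Qed.

Variable C : R.
Hypothesis C0 : (0 <= C)%R.

Definition killed_dyson n x t := (expR (- C * t))%:E * D n x t.
Local Notation K := killed_dyson.

Let K0 n x t : 0 <= K n x t.
Proof. by rewrite mule_ge0// lee_fin expR_ge0. Qed.

Let measurable_kdyson n x : measurable_fun setT (K n x).
Proof.
apply: emeasurable_funM => //.
apply: measurable_EFin_exp.
by apply: measurable_funM => //; exact: measurable_cst.
Qed.

Let kh n r z := W z r * K n z r.
Let kh0 n r z : 0 <= kh n r z. Proof. exact: mule_ge0. Qed.

(** The exponential factor splits multiplicatively at the time r of the
    interaction, so killing at rate C commutes with the Dyson recursion. *)
Lemma killed_dysonS n x t :
  K n.+1 x t = \int[mu]_(r in `[0%R, t]) killed_semigroup X P C (t - r) (kh n r) x.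
Proof.
rewrite {1}/K /= -ge0_integralZl//; last 2 first.
- by apply: measurable_funTS; exact: measurable_semigroup_dyson.
- by move=> r _; exact: semigroup_ge0.
apply: eq_integral => r _; rewrite (killed_semigroupE srw _ _ _ (kh0 n r)).
have -> : semigroup X P (t - r) (kh n r) x =
    (expR (- C * r))%:E * semigroup X P (t - r) (fun z => W z r * D n z r) x.
  rewrite /semigroup -ge0_integralZl//.
  - by apply: eq_integral => w _; rewrite /kh /killed_dyson muleCA.
  - by apply: (measurable_along_walk srw (a := fun=> (t - r)%R) (b := id) (f := fun z _ => W z r * D n z r)).
by rewrite muleA -EFinM -expRD -mulrDr subrK.
Qed.

Let measurable_kill n y : measurable_fun setT
  (fun q : R * R => killed_semigroup X P C (q.2 - q.1) (kh n q.1) y).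
Proof.
rewrite (_ : (fun _ => _) = (fun q : R * R => (expR (- C * (q.2 - q.1)))%:E *
    semigroup X P (q.2 - q.1) (kh n q.1) y)); last first.
  by apply/funext => q; rewrite (killed_semigroupE srw _ _ _ (kh0 n _)).
have mB : measurable_fun setT (fun q : R * R => q.2 - q.1)%R by exact: measurable_funB.
apply: emeasurable_funM.
  apply: measurable_EFin_exp.
  by apply: measurable_funM => //; exact: measurable_cst.
apply: (@measurable_semigroup _ _ _ _ _ _ _ srw _ _ (fun q : R * R => (q.2 - q.1)%R)
   (fun z q => kh n q.1 z)) => // z.
apply: emeasurable_funM; first exact: measurableT_comp.
by apply: (measurableT_comp (measurable_kdyson n z)).
Qed.

Let kill_ge0 n y r s : 0 <= killed_semigroup X P C (s - r) (kh n r) y.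
Proof.
rewrite (killed_semigroupE srw _ _ _ (kh0 n _)) mule_ge0 ?lee_fin ?expR_ge0//.
exact: semigroup_ge0.
Qed.

Let integral_kdysonS n y t :
  \int[mu]_(s in `[0%R, t]) K n.+1 y s =
  \int[mu]_(r in `[0%R, t]) \int[mu]_(s in `[r, t]) killed_semigroup X P C (s - r) (kh n r) y.
Proof.
under eq_integral do rewrite killed_dysonS.
exact: esym (@tonelli_triangle _ (fun q => killed_semigroup X P C (q.2 - q.1) (kh n q.1) y) t
  (measurable_kill n y) (fun q => kill_ge0 n y q.1 q.2)).
Qed.

(** The renewal identity of the killed semigroup, for the function W * K n
    frozen at time r and a start at time r, is integrated over r. Exchanging
    the integrals over the triangle r <= s turns the double integrals into
    integrals of K n.+1. *)
Lemma killed_dyson_renewalS n x t : (0 <= t)%R ->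
  K n.+1 x t + (jump_rate kappa x + C)%:E * \int[mu]_(s in `[0%R, t]) K n.+1 x s =
  \int[mu]_(s in `[0%R, t]) (W x s * K n x s) +
  kappa%:E * \sum_(y <- neighbours x) \int[mu]_(s in `[0%R, t]) K n.+1 y s.
Proof.
move=> t0.
have j0 : 0 <= (jump_rate kappa x + C)%:E by rewrite lee_fin addr_ge0// mulr_ge0.
have k0 : 0 <= kappa%:E by rewrite lee_fin.
have mt : measurable (`[0%R, t]%classic : set (measurableTypeR R)) by [].
pose I y r := \int[mu]_(s in `[r, t]) killed_semigroup X P C (s - r) (kh n r) y.
have mI y : measurable_fun (`[0%R, t]%classic : set (measurableTypeR R)) (I y).
  apply: measurable_funTS.
  exact: (@measurable_integral_x1 _ (fun q => killed_semigroup X P C (q.2 - q.1) (kh n q.1) y) t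
    (measurable_kill n y) (fun q => kill_ge0 n y q.1 q.2)).
have I0 y r : 0 <= I y r by apply: integral_ge0.
have mk : measurable_fun (`[0%R, t]%classic : set (measurableTypeR R))
    (fun r => killed_semigroup X P C (t - r) (kh n r) x).
  apply: measurable_funTS.
  exact: (measurableT_comp (measurable_kill n x) (pair2_measurable t)).
have mkh : measurable_fun (`[0%R, t]%classic : set (measurableTypeR R)) (fun r => kh n r x).
  by apply: measurable_funTS; apply: emeasurable_funM; [exact: mW|exact: measurable_kdyson].
have mcI : measurable_fun (`[0%R, t]%classic : set (measurableTypeR R))
    (fun r => (jump_rate kappa x + C)%:E * I x r).
  by apply: emeasurable_funM; [exact: measurable_cst|exact: mI].
have mS : measurable_fun (`[0%R, t]%classic : set (measurableTypeR R))
    (fun r => \sum_(y <- neighbours x) I y r).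
  by apply: emeasurable_sum => y; exact: mI.
have S0 r : 0 <= \sum_(y <- neighbours x) I y r by apply: sume_ge0.
have mkS : measurable_fun (`[0%R, t]%classic : set (measurableTypeR R))
    (fun r => kappa%:E * \sum_(y <- neighbours x) I y r).
  by apply: emeasurable_funM; [exact: measurable_cst|exact: mS].
transitivity (\int[mu]_(r in `[0%R, t])
    (killed_semigroup X P C (t - r) (kh n r) x + (jump_rate kappa x + C)%:E * I x r)).
  rewrite [RHS](ge0_integralD mu mt (fun r _ => kill_ge0 n x r t) mk
    (fun r _ => mule_ge0 j0 (I0 x r)) mcI).
  rewrite killed_dysonS; congr (_ + _).
  rewrite [RHS](ge0_integralZl mu mt (mI x) (fun r _ => I0 x r) j0).
  by congr (_ * _); exact: integral_kdysonS.
transitivity (\int[mu]_(r in `[0%R, t])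
    (kh n r x + kappa%:E * \sum_(y <- neighbours x) I y r)).
  apply: eq_integral => r; rewrite inE/= in_itv/= => /andP[_ rt].
  exact: (killed_semigroup_renewal srw x kappa_ge0 C0 rt (kh0 n r)).
rewrite [LHS](ge0_integralD mu mt (fun r _ => kh0 n r x) mkh
    (fun r _ => mule_ge0 k0 (S0 r)) mkS); congr (_ + _).
rewrite [LHS](ge0_integralZl mu mt mS (fun r _ => S0 r) k0); congr (_ * _).
rewrite [LHS](ge0_integral_sum mu mt mI (fun y r _ => I0 y r)).
by apply: eq_bigr => y _; rewrite integral_kdysonS.
Qed.

Lemma killed_dyson_renewal0 x t : (0 <= t)%R ->
  K 0 x t + (jump_rate kappa x + C)%:E * \int[mu]_(s in `[0%R, t]) K 0 x s =
  u0 x + kappa%:E * \sum_(y <- neighbours x) \int[mu]_(s in `[0%R, t]) K 0 y s.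
Proof.
move=> t0; have E y s : K 0 y s = killed_semigroup X P C (s - 0) u0 y.
  by rewrite (killed_semigroupE srw _ _ _ u00) subr0.
have EI y : \int[mu]_(s in `[0%R, t]) K 0 y s = \int[mu]_(s in `[0%R, t]) killed_semigroup X P C (s - 0) u0 y.
  by apply: eq_integral => s _; exact: E.
rewrite [X in X + _ = _]E [X in _ + _ * X = _]EI.
under [in RHS]eq_bigr do rewrite EI.
exact: (killed_semigroup_renewal srw x kappa_ge0 C0 t0 u00).
Qed.

Definition dyson_sum x t := \sum_(n <oo) K n x t.
Local Notation S := dyson_sum.

Lemma measurable_dyson_sum x : measurable_fun setT (S x).
Proof. by apply: ge0_emeasurable_sum => // n r _ _; exact: K0. Qed.

Let mt t : measurable (`[0%R, t]%classic : set (measurableTypeR R)).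
Proof. by []. Qed.

Let mK t n x : measurable_fun (`[0%R, t]%classic : set (measurableTypeR R)) (K n x).
Proof. by apply: measurable_funTS; exact: measurable_kdyson. Qed.

Let mWK t n x : measurable_fun (`[0%R, t]%classic : set (measurableTypeR R)) (fun s => W x s * K n x s).
Proof.
by apply: measurable_funTS; apply: emeasurable_funM; [exact: mW|exact: measurable_kdyson].
Qed.

Lemma integral_dyson_sum x t :
  \int[mu]_(s in `[0%R, t]) S x s = \sum_(n <oo) \int[mu]_(s in `[0%R, t]) K n x s.
Proof.
exact: (integral_nneseries mu (@mt t) (fun n => @mK t n x) (fun n s _ => K0 n x s)).
Qed.

(** The identities for the single terms are summed. The terms may be infinite:
    everything is nonnegative and nothing is subtracted. *)
Lemma dyson_sum_renewal x t : (0 <= t)%R -> (forall s, 0 <= s -> W x s \is a fin_num)%R ->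
  S x t + (jump_rate kappa x + C)%:E * \int[mu]_(s in `[0%R, t]) S x s =
  u0 x + \int[mu]_(s in `[0%R, t]) (W x s * S x s) +
  kappa%:E * \sum_(y <- neighbours x) \int[mu]_(s in `[0%R, t]) S y s.
Proof.
move=> t0 Wfin.
have j0 : 0 <= (jump_rate kappa x + C)%:E by rewrite lee_fin addr_ge0// mulr_ge0.
have k0 : 0 <= kappa%:E by rewrite lee_fin.
pose J n y := \int[mu]_(s in `[0%R, t]) K n y s.
have J0 n y : 0 <= J n y by apply: integral_ge0.
pose L n := \int[mu]_(s in `[0%R, t]) (W x s * K n x s).
have L0 n : 0 <= L n by apply: integral_ge0 => s _; exact: mule_ge0.
have cJ0 n : 0 <= (jump_rate kappa x + C)%:E * J n x by exact: mule_ge0.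
have sJ0 n : 0 <= \sum_(y <- neighbours x) J n y by exact: sume_ge0.
have kJ0 n : 0 <= kappa%:E * \sum_(y <- neighbours x) J n y by exact: mule_ge0.
pose a n := K n x t + (jump_rate kappa x + C)%:E * J n x.
have a0 n : 0 <= a n by exact: adde_ge0.
have aS n : a n.+1 = L n + kappa%:E * \sum_(y <- neighbours x) J n.+1 y.
  exact: killed_dyson_renewalS.
have LE : \int[mu]_(s in `[0%R, t]) (W x s * S x s) = \sum_(n <oo) L n.
  transitivity (\int[mu]_(s in `[0%R, t]) \sum_(n <oo) (W x s * K n x s)).
    apply: eq_integral => s; rewrite inE/= in_itv/= => /andP[s0 _].
    rewrite /dyson_sum; case: (W x s) (Wfin s s0) => [v| |]// _.
    by rewrite [RHS]nneseriesZl// => n _; exact: K0.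
  exact: (integral_nneseries mu (@mt t) (fun n => @mWK t n x) (fun n s _ => mule_ge0 (W0 x s) (K0 n x s))).
have shift (f : nat -> \bar R) : (forall n, 0 <= f n) ->
    \sum_(n <oo) f n = f 0%N + \sum_(n <oo) f n.+1.
  move=> f0; rewrite nneseries_recl//; congr (_ + _).
  by rewrite -(nneseries_addn 1 f0); apply: eq_eseriesr => n _; rewrite addn1.
transitivity (\sum_(n <oo) a n).
  rewrite nneseriesD//; congr (_ + _).
  by rewrite [in RHS]nneseriesZl//; congr (_ * _); rewrite integral_dyson_sum.
rewrite shift//; under eq_eseriesr do rewrite aS.
rewrite nneseriesD//.
have -> : a 0%N = u0 x + kappa%:E * \sum_(y <- neighbours x) J 0%N y.
  exact: killed_dyson_renewal0.
rewrite -LE -[LHS]addeA -[RHS]addeA; congr (_ + _); rewrite [LHS]addeCA; congr (_ + _).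
have -> : \sum_(y <- neighbours x) \int[mu]_(s in `[0%R, t]) S y s =
    \sum_(n <oo) \sum_(y <- neighbours x) J n y.
  by rewrite nneseries_sum//; apply: eq_bigr => y _; exact: integral_dyson_sum.
rewrite -nneseriesZl//.
by rewrite [RHS]shift.
Qed.

End Renewal.

(** * Indefinite integrals *)

Section IndefiniteIntegral.
Context {R : realType}.
Local Notation mu := (@lebesgue_measure R).
Variables (u G : R -> R).
Hypothesis iG : forall t, 0 <= t -> mu.-integrable `[0, t] (EFin \o G).
Hypothesis uE : forall t, 0 <= t -> u t = u 0 + \int[mu]_(s in `[0, t]) G s.

Let patched (T : R) := G \_ `[0, T].

Let integrable_patched T : 0 <= T -> mu.-integrable setT (EFin \o patched T).
Proof.
by move=> T0; rewrite /patched -restrict_EFin -integrable_mkcond//; exact: iG.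
Qed.

(** The increments are bounded by the integral of the absolute value of G over
    the union of the intervals, which is small when the union has small
    measure. *)
Lemma indefinite_integral_abs_continuous T : 0 <= T -> abs_continuous T u.
Proof.
move=> T0 e e0.
have [del [del0 hdel]] := integral_normr_continuous (integrable_patched T0) e0.
exists del => // n a b hab disj sumlt.
have itv i : 0 <= a i /\ a i <= b i /\ b i <= T by exact: hab.
pose F i := `]a i, b i]%classic : set (measurableTypeR R).
have mF i : measurable (F i) by exact: measurable_itv.
have tF : trivIset setT F.
  apply/trivIsetP => i j _ _ ij; apply/seteqP; split=> // s [] /=.
  rewrite /F /= !in_itv/= => /andP[ai bi] /andP[aj bj].
  by have [h|h] := disj i j ij; lra.
pose A := \big[setU/set0]_(i <- index_enum 'I_n) F i.
have mA : measurable A by apply: bigsetU_measurable => i _; exact: mF.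
have muF i : (mu (F i) <= (b i - a i)%:E)%E.
  rewrite /F lebesgue_measure_itv/=; case: ifP => _; first by rewrite EFinB.
  by rewrite lee_fin subr_ge0; have [_ []] := itv i.
have muA : (mu A < del%:E)%E.
  rewrite /A -[X in mu X]/(\big[setU/set0]_(i < n) F i) measure_bigsetU_ord//.
  apply: (@le_lt_trans _ _ (\sum_(i < n) (b i - a i))%:E); last by rewrite lte_fin.
  rewrite -sumEFin; apply: lee_sum => i _.
  exact: muF.
have imp D : measurable D -> mu.-integrable D (EFin \o patched T).
  by move=> mD; apply: integrableS (integrable_patched T0).
have imn D : measurable D -> mu.-integrable D (EFin \o (fun s => `|patched T s|)).
  by move=> mD; apply: integrable_norm; exact: imp.
have uab i : u (b i) - u (a i) = \int[mu]_(s in F i) patched T s.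
  have [a0 [ab bT]] := itv i.
  have b0 := le_trans a0 ab.
  rewrite (uE b0) (uE a0) opprD addrACA subrr add0r.
  rewrite (@Rintegral_itvB _ G (BLeft 0) (BRight (b i)) (a i)) ?bnd_simp//.
    apply: eq_Rintegral => s; rewrite inE/= in_itv/= => /andP[sa sb].
    by rewrite /patched patchE mem_set//= in_itv/=; lra.
  exact: iG.
apply: le_lt_trans (hdel A mA muA).
rewrite -lee_fin -sumEFin /Rintegral fineK; last first.
  exact: integrable_fin_num (imn _ mA).
rewrite ge0_integral_bigsetU//; last 3 first.
- exact: index_enum_uniq.
- exact: sub_trivIset tF.
- have := imn _ mA; by move/integrableP => [].
apply: lee_sum => i _.
have iFi : (\int[mu]_(x in F i) `|patched T x|%:E)%E \is a fin_num.
  exact: integrable_fin_num (imn _ (mF i)).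
have := le_normr_Rintegral (mF i) (imp _ (mF i)).
by rewrite uab -lee_fin /Rintegral (fineK iFi).
Qed.

(** Lebesgue's differentiation theorem, applied on each interval from 0 to n. *)
Lemma indefinite_integral_derive :
  {ae mu, forall t : R, 0 <= t -> is_derive t 1 u (G t)}.
Proof.
have H n : {ae mu, forall t : R, 0 < t < n%:R -> is_derive t 1 u (G t)}.
  have n0 : 0 <= n%:R :> R by [].
  have ip := integrable_patched n0.
  have loc : locally_integrable [set: R] (patched n%:R).
    by apply: integrable_locally => //; exact: iG.
  have ip' y : mu.-integrable [set` Interval (BLeft 0) (BRight y)] (EFin \o patched n%:R).
    by apply: integrableS ip.
  have := FTC1 ip' loc; apply: filterS; first exact: (ae_filter_ringOfSetsType mu).
  move=> t ht /andP[t0 tn].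
  have hb : (BLeft (0 : R)%R < BRight t)%E.
    by rewrite lte_fin.
  have [df dfE] := ht hb.
  have gE : G t = patched n%:R t.
    by rewrite /patched patchE mem_set//= in_itv/= !ltW.
  rewrite gE -dfE.
  pose F x := u 0 + \int[mu]_(s in [set` Interval (BLeft 0) (BRight x)]) patched n%:R s.
  apply: (@near_eq_is_derive _ _ _ F).
    have : \forall s \near t, s \in `]0, n%:R[.
      by apply: near_in_itvoo; rewrite in_itv/= t0 tn.
    apply: filterS => s; rewrite in_itv/= => /andP[s0 sn].
    rewrite /F (uE (ltW s0)); congr (_ + _); apply: eq_Rintegral => r.
    rewrite inE/= in_itv/= => /andP[r0 rs].
    by rewrite /patched patchE mem_set//= in_itv/= r0/= (le_trans rs)// ltW.
  rewrite derive1E -[X in is_derive _ _ _ X]add0r.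
  by apply: is_deriveD; exact: DeriveDef.
have N0 : {ae mu, forall t : R, t != 0}.
  exists [set 0]; split=> //; first exact: lebesgue_measure_set1.
  by move=> t /= /negP; rewrite negbK => /eqP.
have HN := ae_foralln H.
apply: (@filterS2 _ _ (ae_filter_ringOfSetsType mu) _ _ _ _ HN N0) => t ht tneq t0.
have tgt : 0 < t by rewrite lt_neqAle eq_sym tneq.
by apply: (ht (Num.truncn t).+1); rewrite tgt truncnS_gt.
Qed.

End IndefiniteIntegral.

(** * Integrals along paths of the walk *)

Section PathRegularity.
Context {R : realType} {d : nat} {disp : measure_display} {T : measurableType disp}.
Variables (kappa : R) (X : R -> T -> 'rV[int]_d) (P : 'rV[int]_d -> probability T R).
Hypothesis srw : simple_random_walk kappa X P.
Notation Z := ('rV[int]_d).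
Local Notation mu := (@lebesgue_measure R).

(** By the one-sided limits the walk takes at most two values near r; a bound
    on their codes is a form of this that compactness can use. *)
Lemma walk_locally_finite w (r : R) : exists N,
  \forall q \near r, (pickle (walk X q w) < N)%N.
Proof.
have right (s : R) : 0 <= s -> exists2 e : R, 0 < e &
    forall q, s <= q -> q < s + e -> walk X q w = walk X s w.
  move=> s0; have := srw_right_continuous srw w s0.
  rewrite near_withinE => /nbhs_ballP[e /= e0 he]; exists e => // q.
  rewrite le_eqVlt => /predU1P[->//|sq qe].
  rewrite !walkE//; last by rewrite (le_trans s0)// ltW.
  by apply: he => //; rewrite /ball/= ltr_distlC; apply/andP; split; lra.
have left : exists2 e : R, 0 < e & exists z, forall q, r - e < q -> q < r -> walk X q w = z.
  have [r0|r0] := ltP 0 r.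
    have [z] := srw_left_limit srw w r0.
    rewrite near_withinE => /nbhs_ballP[e /= e0 he].
    exists (Num.min e r); first by rewrite lt_min e0.
    exists z => q qr1 qr2.
    have [h1 h2] : r - e < q /\ 0 < q.
      by move: qr1; rewrite /Num.min; case: (ltP e r) => ? ?; split; lra.
    rewrite walkE; last exact: ltW.
    by apply: he => //; rewrite /ball/= ltr_distlC; apply/andP; split; lra.
  exists 1 => //; exists (walk X 0 w) => q _ qr.
  by rewrite /walk !max_l//; lra.
have [e1 e10 h1] : exists2 e : R, 0 < e & forall q, r <= q -> q < r + e -> walk X q w = walk X r w.
  have [/right//|r0] := leP 0 r.
  exists (- r); first lra.
  by move=> q rq qr; rewrite /walk !max_l//; lra.
have [e2 e20 [z h2]] := left.
(* the value at r and from the right, and the value z from the left *)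
exists (maxn (pickle (walk X r w)) (pickle z)).+1.
apply/nbhs_ballP; exists (Num.min e1 e2); first by rewrite /= lt_min e10.
move=> q /=; rewrite /ball/= ltr_distlC => /andP[q1 q2].
have [? ?] : r - e2 < q /\ q < r + e1.
  by move: q1 q2; rewrite /Num.min; case: (ltP e1 e2) => ? ? ?; split; lra.
rewrite ltnS leq_max; have [qr|rq] := ltP q r.
  by rewrite h2// leqnn orbT.
by rewrite h1// leqnn.
Qed.

Lemma walk_finite_range w (t : R) : exists N, forall r, 0 <= r <= t ->
  (pickle (walk X r w) < N)%N.
Proof.
have /compact_near_coveringP := @segment_compact R 0 t.
move=> /(_ nat \oo (fun n r => (pickle (walk X r w) < n)%N) _).
have H : forall r, `[0, t]%classic r -> \forall r' \near r & n \near \oo,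
    (pickle (walk X r' w) < n)%N.
  move=> r _; have [N hN] := walk_locally_finite w r.
  exists ([set q | (pickle (walk X q w) < N)%N], [set n | (N <= n)%N]) => /=.
    by split => //; exists N.
  by move=> [q n] /= [qN Nn]; exact: leq_trans Nn.
move=> /(_ H) [N _ hN]; exists N => r rt.
by apply: (hN N) => //=; rewrite in_itv.
Qed.

Local Open Scope ereal_scope.

(** Only finitely many sites are visited, so the integral is at most a finite
    sum of integrals at fixed sites. *)
Lemma integral_along_walk_lty (g : Z -> R -> \bar R) (t : R) w :
  (forall z, measurable_fun setT (g z)) -> (forall z r, 0 <= g z r) ->
  (forall z, \int[mu]_(r in `[0%R, t]) g z r < +oo) ->
  \int[mu]_(r in `[0%R, t]) g (walk X (t - r) w) r < +oo.
Proof.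
move=> mg g0 gfin; have [N hN] := walk_finite_range w t.
pose G n r := oapp (fun z => g z r) 0 (@pickle_inv Z n).
have mG n : measurable_fun setT (G n).
  by rewrite /G; case: pickle_inv => /= [z|]; [exact: mg|exact: measurable_cst].
have G0 n r : 0 <= G n r by rewrite /G; case: pickle_inv => //=.
have mt : measurable (`[0%R, t]%classic : set (measurableTypeR R)) by [].
apply: (@le_lt_trans _ _ (\int[mu]_(r in `[0%R, t]) \sum_(n < N) G n r)).
  apply: ge0_le_integral => //.
  - apply: measurable_funTS.
    apply: (measurable_along_walk srw (a := fun r : R => (t - r)%R) (b := fun=> w) (f := g)) => //.
    by apply: measurable_funB => //; exact: measurable_cst.
  - by apply: measurable_funTS; apply: emeasurable_sum => n; exact: mG.
  move=> r; rewrite /= in_itv/= => /andP[r0 rt].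
  have /hN lt : (0 <= t - r <= t)%R by rewrite subr_ge0 rt lerBlDr lerDl.
  rewrite (bigD1 (Ordinal lt))//= {1}/G pickleK_inv/= leeDl//.
  by apply: sume_ge0.
rewrite (ge0_integral_sum mu mt (fun n : 'I_N => measurable_funTS (mG n)) (fun n r _ => G0 n r)).
apply: lte_sum_pinfty => n _; rewrite /G; case: pickle_inv => /= [z|]; first exact: gfin.
by rewrite integral0.
Qed.

End PathRegularity.

(** * The Feynman-Kac formula for potentials bounded below *)

Section FeynmanKac.
Context {R : realType} {d : nat} {disp : measure_display} {T : measurableType disp}.
Variables (kappa : R) (X : R -> T -> 'rV[int]_d) (P : 'rV[int]_d -> probability T R).
Hypothesis srw : simple_random_walk kappa X P.
Notation Z := ('rV[int]_d).
Local Notation mu := (@lebesgue_measure R).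
Local Open Scope ereal_scope.

Lemma integral_reflect_signed (t : R) (f : R -> \bar R) :
  measurable_fun setT f ->
  \int[mu]_(r in `[0%R, t]) f r = \int[mu]_(r in `[0%R, t]) f (t - r)%R.
Proof.
move=> mf.
have H (g : R -> \bar R) : measurable_fun setT g -> (forall r, 0 <= g r) ->
    \int[mu]_(r in `[0%R, t]) g r = \int[mu]_(r in `[0%R, t]) g (t - r)%R.
  by move=> mg g0; rewrite (integral_reflect t 0 mg g0) subr0.
rewrite [LHS]integralE [RHS]integralE; congr (_ - _).
- rewrite (H f^\+); [|exact: measurable_funepos|by move=> r; exact: funepos_ge0].
  by apply: eq_integral => r _; rewrite !funeposE.
- rewrite (H f^\-); [|exact: measurable_funeneg|by move=> r; exact: funeneg_ge0].
  by apply: eq_integral => r _; rewrite !funenegE.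
Qed.

Variable U : Z -> R -> R.
Hypothesis mU : forall z, measurable_fun setT (U z).
Hypothesis iU : forall z (t : R), (0 <= t)%R -> mu.-integrable `[0%R, t] (EFin \o U z).

Let along (t : R) w r := U (walk X (t - r) w) r.

Let measurable_along2 t : measurable_fun setT (fun q : T * R => along t q.1 q.2).
Proof.
apply: (measurable_along_walk srw (a := fun q : T * R => (t - q.2)%R) (b := fst)
  (f := fun z q => U z q.2)) => //.
  by apply: measurable_funB => //; exact: measurable_cst.
by move=> z; exact: measurableT_comp.
Qed.

Lemma measurable_along_path t w : measurable_fun setT (along t w).
Proof.
apply: (measurable_along_walk srw (a := fun r : R => (t - r)%R) (b := fun=> w) (f := U)) => //.
by apply: measurable_funB => //; exact: measurable_cst.
Qed.

Lemma integrable_along_path (t : R) w : (0 <= t)%R ->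
  mu.-integrable `[0%R, t] (EFin \o along t w).
Proof.
move=> t0; apply/integrableP; split.
  by apply: measurable_funTS; apply/measurable_EFinP; exact: measurable_along_path.
apply: (integral_along_walk_lty srw (g := fun z r => `|(U z r)%:E|)) => //.
  by move=> z; apply: measurableT_comp => //; apply/measurable_EFinP.
by move=> z; have /integrableP[] := iU z t0.
Qed.

(** The integral of the potential along the path, after the change of variable
    r = t - s. *)
Definition path_integral (t : R) (w : T) : R := (\int[mu]_(r in `[0%R, t]) along t w r)%R.

Lemma measurable_path_integral t : measurable_fun setT (path_integral t).
Proof.
rewrite /path_integral /Rintegral.
apply: (@measurableT_comp _ _ _ _ _ _ fine) => //.
have mE : measurable_fun setT (fun q : T * R => (along t q.1 q.2)%:E).
  by apply/measurable_EFinP.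
rewrite (_ : (fun _ => _) = (fun w =>
   \int[mu]_(r in `[0%R, t]) (fun q : T * R => (along t q.1 q.2)%:E)^\+ (w, r) -
   \int[mu]_(r in `[0%R, t]) (fun q : T * R => (along t q.1 q.2)%:E)^\- (w, r))).
  apply: emeasurable_funB.
    by apply: measurable_integral2 => //; exact: measurable_funepos.
  by apply: measurable_integral2 => //; exact: measurable_funeneg.
apply/funext => w; rewrite integralE; congr (_ - _); apply: eq_integral => r _.
  by rewrite !funeposE.
by rewrite !funenegE.
Qed.

Variable u0 : Z -> R.

Lemma feynman_kacE x (t : R) : (0 <= t)%R ->
  feynman_kac X P U u0 x t =
  \int[P x]_w (expR (path_integral t w) * u0 (walk X t w))%:E.
Proof.
move=> t0; apply: eq_integral => w _; congr EFin; rewrite (walkE X t0).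
congr (expR _ * _)%R; rewrite /path_integral /Rintegral; congr fine.
pose f (s : R) := (U (walk X s w) (t - s))%:E.
have mf : measurable_fun setT f.
  apply/measurable_EFinP.
  apply: (measurable_along_walk srw (a := id) (b := fun=> w) (f := fun z s => U z (t - s)%R)) => // z.
  apply: (measurableT_comp (mU z)).
  by apply: measurable_funB => //; exact: measurable_cst.
transitivity (\int[mu]_(s in `[0%R, t]) f s).
  by apply: eq_integral => s; rewrite inE/= in_itv/= => /andP[s0 _]; rewrite /f (walkE X s0).
rewrite integral_reflect_signed//.
by apply: eq_integral => s _; rewrite /f /along subKr.
Qed.

Hypothesis u00 : forall z, (0 <= u0 z)%R.
Variable C : R.
Hypothesis CU : forall z r, (- C <= U z r)%R.

Let W z r := (U z r + C)%:E.

(** Raising the potential by C makes it nonnegative and multiplies the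
    expectation by exp (C * t), which killing at rate C takes back. *)
Lemma feynman_kac_dyson_sum x (t : R) : (0 <= t)%R ->
  feynman_kac X P U u0 x t = dyson_sum X P W (EFin \o u0) C x t.
Proof.
move=> t0.
have mW z : measurable_fun setT (W z).
  by apply/measurable_EFinP; apply: measurable_funD => //; exact: measurable_cst.
have W0 z r : 0 <= W z r by rewrite lee_fin; have := CU z r; lra.
have u0' z : 0 <= (EFin \o u0) z by rewrite lee_fin.
have mt : measurable (`[0%R, t]%classic : set (measurableTypeR R)) by [].
have icst : mu.-integrable (`[0%R, t]%classic : set (measurableTypeR R)) (EFin \o (fun _ : R => C)).
  apply: continuous_compact_integrable; first exact: segment_compact.
  by apply: continuous_subspaceT => s; exact: cvg_cst.
have iW w : \int[mu]_(r in `[0%R, t]) path_potential X W t w r =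
    (path_integral t w + C * t)%:E.
  transitivity (\int[mu]_(r in `[0%R, t]) ((along t w r)%:E + C%:E)).
    by apply: eq_integral => r _; rewrite /path_potential /W EFinD.
  rewrite (integralD_EFin mt (integrable_along_path w t0) icst) EFinD.
  rewrite /path_integral /Rintegral fineK; last first.
    exact: integrable_fin_num (integrable_along_path w t0).
  congr (_ + _); transitivity (C%:E * mu (`[0%R, t]%classic : set (measurableTypeR R))).
    exact: integral_cst.
  rewrite lebesgue_measure_itv/= lte_fin.
  case: ltP => [_|t0']; first by rewrite sube0 EFinM.
  have -> : t = 0%R by lra.
  by rewrite mule0 mulr0.
have H w : \int[mu]_(r in `[0%R, t]) path_potential X W t w r < +oo.
  by rewrite iW ltry.
rewrite feynman_kacE// /dyson_sum /killed_dyson nneseriesZl; last first.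
  by move=> n _; exact: dyson_ge0.
have fin0 z : (EFin \o u0) z \is a fin_num by [].
rewrite -(feynman_kac_dyson srw mW W0 u0' x t0 fin0 H).
rewrite -ge0_integralZl//; last 2 first.
- apply: emeasurable_funM.
    rewrite (_ : (fun _ => _) = (fun w => (expR (path_integral t w + C * t))%:E)).
      apply: measurable_EFin_exp; apply: measurable_funD => //.
      exact: measurable_path_integral.
    by apply/funext => w; rewrite iW.
  by apply: (measurable_along_walk srw (a := fun _ : T => t) (b := id) (f := fun z _ => (u0 z)%:E)).
- by move=> w _; rewrite mule_ge0// lee_fin expR_ge0.
apply: eq_integral => w _; rewrite iW /= -!EFinM mulrA -expRD.
by congr ((expR _ * _)%:E); ring.
Qed.

End FeynmanKac.

(** * Locally integrable potentials *)

Section RealIntegrals.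
Context d (T : measurableType d) (R : realType) (mu : {measure set T -> \bar R}).
Variables (D : set T) (mD : measurable D).

Lemma dominated_Rintegral (f_ : nat -> T -> R) (f g : T -> R) :
  (forall n, measurable_fun D (f_ n)) -> measurable_fun D f ->
  (forall x, D x -> f_ ^~ x @ \oo --> f x) ->
  mu.-integrable D (EFin \o g) -> (forall n x, D x -> `|f_ n x| <= g x) ->
  mu.-integrable D (EFin \o f) /\
  (\int[mu]_(x in D) f_ n x)%R @[n --> \oo] --> (\int[mu]_(x in D) f x)%R.
Proof.
move=> mf_ mf cf ig fg.
have [] := @dominated_convergence _ _ _ mu D mD (fun n x => (f_ n x)%:E) (EFin \o f) (EFin \o g).
- by move=> n; apply/measurable_EFinP.
- by apply/measurable_EFinP.
- by apply: aeW => x Dx; apply: cvg_EFin; [exact: nearW|exact: cf].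
- exact: ig.
- by apply: aeW => x n Dx; rewrite /= lee_fin fg.
move=> iF _ cF; split=> //.
have fE : (\int[mu]_(x in D) (EFin \o f) x)%E = (\int[mu]_(x in D) f x)%R%:E.
  by rewrite /Rintegral fineK//; exact: integrable_fin_num iF.
rewrite fE in cF; exact: fine_cvg cF.
Qed.

Lemma integrable_sum_EFin (I : Type) (s : seq I) (F : I -> T -> R) :
  (forall i, mu.-integrable D (EFin \o F i)) ->
  mu.-integrable D (EFin \o (fun x => \sum_(i <- s) F i x)).
Proof.
move=> iF.
have := @integrable_sum _ _ _ mu D mD I s xpredT (fun i => EFin \o F i) (fun i _ => iF i).
by apply: eq_integrable => // x _; rewrite /= sumEFin.
Qed.

Lemma Rintegral_sum (I : Type) (s : seq I) (F : I -> T -> R) :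
  (forall i, mu.-integrable D (EFin \o F i)) ->
  \int[mu]_(x in D) (\sum_(i <- s) F i x) = \sum_(i <- s) \int[mu]_(x in D) F i x.
Proof.
move=> iF; elim: s => [|i s IH].
  by rewrite big_nil; under eq_Rintegral do rewrite big_nil; rewrite Rintegral_cst// mul0r.
rewrite big_cons -IH -RintegralD//; last exact: integrable_sum_EFin.
by apply: eq_Rintegral => x _; rewrite big_cons.
Qed.

End RealIntegrals.

(** Among finite quantities the loss term k * N * J and the killing term C * J
    can be cancelled in the renewal identity; the right-hand side is the
    integral form of the equation. *)
Lemma renewal_cancel {R : realType} (k C a b I J N S : R) :
  a + (k * N + C) * J = b + (I + C * J) + k * S -> a = b + (I + (k * S - k * N * J)).
Proof. by move=> h; lra. Qed.

Lemma cvg_sum_seq {R : realType} (I : Type) (s : seq I) (f : I -> nat -> R) (l : I -> R) :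
  (forall i, f i n @[n --> \oo] --> l i) ->
  \sum_(i <- s) f i n @[n --> \oo] --> \sum_(i <- s) l i.
Proof.
move=> fl; elim: s => [|i s IH].
  rewrite big_nil (_ : (fun _ => _) = cst 0); first exact: cvg_cst.
  by apply/funext => n; rewrite big_nil.
rewrite big_cons (_ : (fun _ => _) = (fun n => f i n + \sum_(i <- s) f i n)).
  by apply: cvgD.
by apply/funext => n; rewrite big_cons.
Qed.

Section Solution.
Context {R : realType} {d : nat} {disp : measure_display} {T : measurableType disp}.
Variables (kappa : R) (X : R -> T -> 'rV[int]_d) (P : 'rV[int]_d -> probability T R).
Hypothesis srw : simple_random_walk kappa X P.
Hypothesis kappa_ge0 : 0 <= kappa.
Notation Z := ('rV[int]_d).
Local Notation mu := (@lebesgue_measure R).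

Lemma feynman_kac_ext (V V' : Z -> R -> R) (u0 : Z -> R) x t :
  (forall z s, 0 <= s <= t -> V z s = V' z s) ->
  feynman_kac X P V u0 x t = feynman_kac X P V' u0 x t.
Proof.
move=> VV'; apply: eq_integral => w _; congr ((expR _ * _)%:E).
apply: eq_Rintegral => s; rewrite inE/= in_itv/= => /andP[s0 st].
by apply: VV'; rewrite subr_ge0 st lerBlDr lerDl.
Qed.

Variables (V : Z -> R -> R) (u0 : Z -> R).
Hypothesis iV : forall x (t : R), 0 <= t ->
  mu.-integrable `[0, t] (fun s => (V x s)%:E).
Hypothesis u0_ge0 : forall x, 0 <= u0 x.
Hypothesis fin : forall x (n : nat),
  (feynman_kac X P (fun z s => Num.max (V z s) 0)%R u0 x n.+1%:R < +oo)%E.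

(** The potential is set to 0 at negative times, about which nothing is
    assumed, so that it becomes measurable on the whole line. *)
Let Vp z := V z \_ `[0, +oo[.

Let VpE z s : 0 <= s -> Vp z s = V z s.
Proof. by move=> s0; rewrite /Vp patchE mem_set//= in_itv/= s0. Qed.

Let mVp z : measurable_fun setT (Vp z).
Proof.
apply/(measurable_restrictT _ _).1 => //.
rewrite itv0y_bigcup0S; apply/measurable_fun_bigcup => // n.
by have /integrableP[/measurable_EFinP] := iV z (ler0n R n.+1).
Qed.

Let mt (t : R) : measurable (`[0, t]%classic : set (measurableTypeR R)).
Proof. by []. Qed.

Let iVp z (t : R) : 0 <= t -> mu.-integrable `[0, t] (EFin \o Vp z).
Proof.
move=> t0; apply: eq_integrable (iV z t0) => // s.
by rewrite inE/= in_itv/= => /andP[s0 _]; rewrite VpE.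
Qed.

Let cut (C : R) z r := Num.max (Vp z r) (- C).

Let measurable_cut C z : measurable_fun setT (cut C z).
Proof. by apply: measurable_maxr => //; exact: measurable_cst. Qed.

Let cut_norm C z r : 0 <= C -> `|cut C z r| <= `|Vp z r|.
Proof.
move=> C0; rewrite /cut /Num.max; case: ltP => // vC.
by rewrite normrN (ger0_norm C0) ler0_norm; lra.
Qed.

Let integrable_cut C z (t : R) : 0 <= C -> 0 <= t -> mu.-integrable `[0, t] (EFin \o cut C z).
Proof.
move=> C0 t0; apply: le_integrable (iVp z t0) => //.
  by apply: measurable_funTS; apply/measurable_EFinP; exact: measurable_cut.
by move=> r _; rewrite /= lee_fin; exact: cut_norm.
Qed.

Let cut_ge C z r : - C <= cut C z r.
Proof. by rewrite /cut le_max lexx orbT. Qed.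

Let cut_le0 C z r : 0 <= C -> cut C z r <= cut 0 z r.
Proof. by move=> C0; rewrite /cut ge_max !le_max oppr0 lexx/= oppr_le0 C0 orbT. Qed.

Let fk C x t := feynman_kac X P (cut C) u0 x t.

Let fkE C x t : 0 <= C -> 0 <= t -> fk C x t =
  dyson_sum X P (fun z r => (cut C z r + C)%:E) (EFin \o u0) C x t.
Proof.
move=> C0 t0; apply: (feynman_kac_dyson_sum srw) => //.
by move=> z s s0; exact: integrable_cut.
Qed.

Let fk_integral C x (t : R) : 0 <= C -> 0 <= t -> fk C x t =
  (\int[P x]_w (expR (path_integral X (cut C) t w) * u0 (walk X t w))%:E)%E.
Proof.
move=> C0 t0.
exact: (feynman_kacE srw (measurable_cut C) u0 x t0).
Qed.

(** The larger cut-off potential dominates; this is the majorant that allows C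
    to tend to infinity. *)
Let fk_le0 C x (t : R) : 0 <= C -> 0 <= t -> (fk C x t <= fk 0 x t)%E.
Proof.
move=> C0 t0; rewrite (fk_integral x C0 t0) (fk_integral x (lexx 0) t0).
have me D : 0 <= D -> measurable_fun setT (fun w =>
    (expR (path_integral X (cut D) t w) * u0 (walk X t w))%:E).
  move=> D0; rewrite (_ : (fun _ => _) = (fun w => (expR (path_integral X (cut D) t w))%:E * (u0 (walk X t w))%:E)%E)//.
  apply: emeasurable_funM.
    by apply: measurable_EFin_exp; exact: (measurable_path_integral srw).
  by apply: (measurable_along_walk srw (a := fun _ : T => t) (b := id) (f := fun z _ => (u0 z)%:E)).
apply: ge0_le_integral => //.
- by move=> w _; rewrite lee_fin mulr_ge0 ?expR_ge0.
- exact: me.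
- exact: me.
move=> w _; rewrite lee_fin ler_wpM2r// ler_expR.
apply: le_Rintegral => //.
- by apply: (integrable_along_path srw) => // z s s0; exact: integrable_cut.
- by apply: (integrable_along_path srw) => // z s s0; exact: integrable_cut.
- by move=> r _; exact: cut_le0.
Qed.

Let fk_ge0 C x t : (0 <= fk C x t)%E.
Proof. by apply: integral_ge0 => w _; rewrite lee_fin mulr_ge0 ?expR_ge0. Qed.

Let fk_nat x n : (fk 0 x n.+1%:R < +oo)%E.
Proof.
have -> : fk 0 x n.+1%:R =
    feynman_kac X P (fun z s => Num.max (V z s) 0)%R u0 x n.+1%:R.
  apply: feynman_kac_ext => z s /andP[s0 _].
  by rewrite /cut VpE// oppr0.
exact: fin.
Qed.

(** Nonnegativity of the cut-off potential makes the weighted solution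
    monotone in time, so finiteness at integer times bounds it locally. *)
Let bound x (t : R) : R :=
  expR (jump_rate kappa x * (Num.truncn t).+1%:R) * fine (fk 0 x (Num.truncn t).+1%:R).

Let fk_bound C x (s t : R) : 0 <= C -> 0 <= s -> s <= t -> (fk C x s <= (bound x t)%:E)%E.
Proof.
move=> C0 s0 st; apply: le_trans (fk_le0 x C0 s0) _.
set n := (Num.truncn t).+1; have tn : t < n%:R by exact: truncnS_gt.
have j0 : 0 <= jump_rate kappa x by rewrite mulr_ge0.
have n0 : 0 <= n%:R :> R by [].
have nfin : fk 0 x n%:R \is a fin_num.
  by rewrite (ge0_fin_numE (fk_ge0 _ _ _)); exact: fk_nat.
have -> : (bound x t)%:E = ((expR (jump_rate kappa x * n%:R))%:E * fk 0 x n%:R)%E.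
  by rewrite -[in RHS](fineK nfin) -EFinM.
rewrite (fkE x (lexx 0) s0) (fkE x (lexx 0) n0) /dyson_sum.
have K1 r D : killed_dyson X P (fun z r => (cut 0 z r + 0)%:E) (EFin \o u0) 0 D x r =
    dyson X P (fun z r => (cut 0 z r + 0)%:E) (EFin \o u0) D x r.
  by rewrite /killed_dyson oppr0 mul0r expR0 mul1e.
under eq_eseriesr do rewrite K1.
under [X in (_ <= _ * X)%E]eq_eseriesr do rewrite K1.
have W0 z r : (0 <= (cut 0 z r + 0)%:E)%E.
  by rewrite lee_fin addr0; have := cut_ge 0 z r; rewrite oppr0.
have mW z : measurable_fun setT (fun r => (cut 0 z r + 0)%:E).
  by apply/measurable_EFinP; apply: measurable_funD => //; exact: measurable_cst.
have u0' z : (0 <= (EFin \o u0) z)%E by rewrite lee_fin.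
rewrite -nneseriesZl; last by move=> i _; exact: dyson_ge0.
apply: lee_nneseries => [i _ _|i _]; first exact: dyson_ge0.
apply: le_trans (dyson_weight_ndecr srw kappa_ge0 mW W0 u0' i x s0 (ltW (le_lt_trans st tn))).
rewrite -[leLHS]mul1e; apply: lee_wpmul2r; first exact: dyson_ge0.
by rewrite lee_fin -expR0 ler_expR mulr_ge0.
Qed.

Let g C y s := fine (fk C y s).

Let fkg C y (s : R) : 0 <= C -> 0 <= s -> fk C y s = (g C y s)%:E.
Proof.
move=> C0 s0; rewrite /g fineK// (ge0_fin_numE (fk_ge0 _ _ _)).
exact: le_lt_trans (fk_bound y C0 s0 (lexx s)) (ltry _).
Qed.

Let g_ge0 C y s : 0 <= g C y s.
Proof. exact: fine_ge0. Qed.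

Let g_bound C y (s t : R) : 0 <= C -> 0 <= s -> s <= t -> g C y s <= bound y t.
Proof. by move=> C0 s0 st; rewrite -lee_fin -(fkg y C0 s0) fk_bound. Qed.

Let measurable_g C y (t : R) : 0 <= C ->
  measurable_fun (`[0, t]%classic : set (measurableTypeR R)) (g C y).
Proof.
move=> C0.
pose S := dyson_sum X P (fun z r => (cut C z r + C)%:E) (EFin \o u0) C y.
have mS : measurable_fun setT S.
  apply: (measurable_dyson_sum srw) => [z|z r|z].
  - by apply/measurable_EFinP; apply: measurable_funD => //; exact: measurable_cst.
  - by rewrite lee_fin; have := cut_ge C z r; lra.
  - by rewrite lee_fin.
apply: (@eq_measurable_fun _ _ _ _ _ (fine \o S)).
  by move=> s; rewrite inE/= in_itv/= => /andP[s0 _]; rewrite /g (fkE y C0 s0).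
apply: measurable_funTS; exact: (measurableT_comp (fine_measurable measurableT) mS).
Qed.

Let bounded_g C y (t : R) : 0 <= C -> [bounded g C y s | s in `[0, t]%classic].
Proof.
move=> C0; exists (bound y t); split; first exact: num_real.
move=> N BN s; rewrite /= in_itv/= => /andP[s0 st].
by rewrite ger0_norm// (le_trans (g_bound y C0 s0 st))// ltW.
Qed.

Let integrable_g C y (t : R) : 0 <= C -> mu.-integrable `[0, t] (EFin \o g C y).
Proof.
move=> C0; apply: measurable_bounded_integrable => //.
- have := lebesgue_measure_itv `[0, t]; rewrite /= => ->.
  by case: ifP => _; rewrite ?ltry// EFinN -EFinD ltry.
- exact: measurable_g.
- exact: bounded_g.
Qed.

Let integrable_cut_g C y (t : R) : 0 <= C -> 0 <= t ->
  mu.-integrable `[0, t] (EFin \o (fun s => cut C y s * g C y s)).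
Proof.
move=> C0 t0.
exact: (integrableMl (@mt t) (@integrable_cut C y t C0 t0) (@measurable_g C y t C0) (@bounded_g C y t C0)).
Qed.

(** The renewal identity for the shifted potential cut C + C holds between
    quantities that are finite by the local bound. *)
Let cut_equation C x (t : R) : 0 <= C -> 0 <= t ->
  g C x t = u0 x + \int[mu]_(s in `[0, t])
    (cut C x s * g C x s + kappa * laplacian (fun y => g C y s) x).
Proof.
move=> C0 t0.
have mW z : measurable_fun setT (fun r => (cut C z r + C)%:E).
  by apply/measurable_EFinP; apply: measurable_funD => //; exact: measurable_cst.
have W0 z r : (0 <= (cut C z r + C)%:E)%E.
  by rewrite lee_fin; have := cut_ge C z r; lra.
have u0' z : (0 <= (EFin \o u0) z)%E by rewrite lee_fin.
have xfin s : 0 <= s -> (cut C x s + C)%:E \is a fin_num by [].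
have := dyson_sum_renewal srw kappa_ge0 mW W0 u0' C0 t0 xfin.
have iS y : (\int[mu]_(s in `[0%R, t]) dyson_sum X P (fun z r => (cut C z r + C)%:E) (EFin \o u0) C y s
    = (\int[mu]_(s in `[0, t]) g C y s)%R%:E)%E.
  rewrite /Rintegral fineK; last exact: integrable_fin_num (@integrable_g C y t C0).
  apply: eq_integral => s; rewrite inE/= in_itv/= => /andP[s0 _].
  by rewrite -(fkE y C0 s0) fkg.
have ig y := @integrable_g C y t C0.
have icg := @integrable_cut_g C x t C0 t0.
have iCg : mu.-integrable `[0, t] (EFin \o (fun s => C * g C x s)).
  exact: eq_integrable (integrableZl (@mt t) C (ig x)).
have iW : (\int[mu]_(s in `[0%R, t]) ((cut C x s + C)%:E *
    dyson_sum X P (fun z r => (cut C z r + C)%:E) (EFin \o u0) C x s)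
    = (\int[mu]_(s in `[0, t]) (cut C x s * g C x s) + C * \int[mu]_(s in `[0, t]) g C x s)%R%:E)%E.
  rewrite -(RintegralZl C (@mt t) (ig x)) -(RintegralD (@mt t) icg iCg) /Rintegral fineK; last first.
    have := integrableD (@mt t) icg iCg => i.
    by apply: integrable_fin_num => //; apply: eq_integrable i.
  apply: eq_integral => s; rewrite inE/= in_itv/= => /andP[s0 _].
  by rewrite -(fkE x C0 s0) (fkg x C0 s0) -EFinM mulrDl.
rewrite (iS x) iW -(fkE x C0 t0) (fkg x C0 t0).
under eq_bigr do rewrite iS.
rewrite sumEFin /= -!EFinM -!EFinD => -[h].
pose J y := \int[mu]_(s in `[0, t]) g C y s.
have isum : mu.-integrable `[0, t] (EFin \o (fun s => \sum_(y <- neighbours x) g C y s)).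
  by apply: integrable_sum_EFin => // y; exact: ig.
have iN : mu.-integrable `[0, t] (EFin \o (fun s => (size (neighbours x))%:R * g C x s)).
  exact: eq_integrable (integrableZl (@mt t) (size (neighbours x))%:R (ig x)).
have il : mu.-integrable `[0, t] (EFin \o (fun s => laplacian (fun y => g C y s) x)).
  have := integrableB (@mt t) isum iN; apply: eq_integrable => // s _.
  by rewrite /= laplacian_gain_loss EFinB.
have ikl : mu.-integrable `[0, t] (EFin \o (fun s => kappa * laplacian (fun y => g C y s) x)).
  exact: eq_integrable (integrableZl (@mt t) kappa il).
rewrite RintegralD//.
rewrite (RintegralZl kappa (@mt t) il).
have -> : \int[mu]_(s in `[0, t]) laplacian (fun y => g C y s) x =
    \sum_(y <- neighbours x) J y - (size (neighbours x))%:R * J x.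
  rewrite /J -(RintegralZl _ (@mt t) (ig x)) -Rintegral_sum// -RintegralB//.
  by apply: eq_Rintegral => s _; rewrite laplacian_gain_loss.
rewrite mulrBr mulrA; exact: (renewal_cancel h).
Qed.

Let cut_cvg z r : cut n%:R z r @[n --> \oo] --> Vp z r.
Proof.
apply: cvg_near_cst; exists (Num.truncn `|Vp z r|).+1 => // n /= Nn.
rewrite /cut max_l// lerNl.
have h : `|Vp z r| < n%:R by apply: (lt_le_trans (truncnS_gt _)); rewrite ler_nat.
by have := ler_norm (- Vp z r); rewrite normrN; lra.
Qed.

Let path_integral_cvg (t : R) w : 0 <= t ->
  (path_integral X (cut n%:R) t w @[n --> \oo] --> path_integral X Vp t w).
Proof.
move=> t0.
have mal (U : Z -> R -> R) : (forall z, measurable_fun setT (U z)) ->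
    measurable_fun (`[0, t]%classic : set (measurableTypeR R)) (fun r => U (walk X (t - r) w) r).
  by move=> mU; apply: measurable_funTS; exact: (measurable_along_path srw mU).
have [] := @dominated_Rintegral _ _ _ mu _ (@mt t)
  (fun n r => cut n%:R (walk X (t - r) w) r) (fun r => Vp (walk X (t - r) w) r)
  (fun r => `|Vp (walk X (t - r) w) r|).
- by move=> n; apply: mal => z; exact: measurable_cut.
- exact: mal.
- by move=> r _; exact: cut_cvg.
- by apply: integrable_norm; exact: (integrable_along_path srw mVp iVp).
- by move=> n r _; exact: cut_norm.
by [].
Qed.

Let weight (U : Z -> R -> R) (t : R) w := expR (path_integral X U t w) * u0 (walk X t w).

Let measurable_weight (U : Z -> R -> R) t : (forall z, measurable_fun setT (U z)) ->
  measurable_fun setT (weight U t).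
Proof.
move=> mU; apply: measurable_funM.
  by apply: measurableT_comp => //; exact: (measurable_path_integral srw).
by apply: (measurable_along_walk srw (a := fun _ : T => t) (b := id) (f := fun z _ => u0 z)).
Qed.

Let fkV x (t : R) : 0 <= t ->
  feynman_kac X P V u0 x t = (\int[P x]_w (weight Vp t w)%:E)%E.
Proof.
move=> t0; rewrite -(feynman_kacE srw mVp u0 x t0).
by apply: feynman_kac_ext => z s /andP[s0 _]; rewrite VpE.
Qed.

Let u x t := fine (feynman_kac X P V u0 x t).

(** Cutting off at -n and letting n tend to infinity: the path integrals
    converge because the potential is integrable along every path, and the
    expectations are dominated by the one for the cut-off at level 0. *)
Let solution_limit x (t : R) : 0 <= t ->
  feynman_kac X P V u0 x t \is a fin_num /\ (g n%:R x t @[n --> \oo] --> u x t).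
Proof.
move=> t0.
have path_le n w : path_integral X (cut n%:R) t w <= path_integral X (cut 0) t w.
  apply: le_Rintegral => //.
  - by apply: (integrable_along_path srw) => // z s s0; exact: integrable_cut.
  - by apply: (integrable_along_path srw) => // z s s0; exact: integrable_cut.
  - by move=> r _; exact: cut_le0.
have [] := @dominated_Rintegral _ _ _ (P x) setT measurableT
  (fun n => weight (cut n%:R) t) (weight Vp t) (weight (cut 0) t).
- by move=> n; apply: measurable_weight; exact: measurable_cut.
- exact: measurable_weight.
- move=> w _; apply: cvgMr_tmp.
  apply: (@cvg_comp _ _ _ (fun n => path_integral X (cut n%:R) t w) expR).
    exact: path_integral_cvg.
  exact: continuous_expR.
- apply/integrableP; split.
    by apply/measurable_EFinP; apply: measurable_weight; exact: measurable_cut.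
  have := fk_bound x (lexx 0) t0 (lexx t); rewrite (fk_integral x (lexx 0) t0) => h.
  apply: le_lt_trans (ltry (bound x t)); apply: le_trans h.
  rewrite le_eqVlt; apply/orP; left; apply/eqP; apply: eq_integral => w _.
  by rewrite /= ger0_norm// mulr_ge0 ?expR_ge0.
- move=> n w _; rewrite /weight ger0_norm ?mulr_ge0 ?expR_ge0//.
  by rewrite ler_wpM2r// ler_expR.
move=> iW cW; split.
  by rewrite fkV//; exact: integrable_fin_num iW.
rewrite /u fkV//.
rewrite (_ : (fun n => g n%:R x t) = (fun n => \int[P x]_w weight (cut n%:R) t w)) //.
by apply/funext => n; rewrite /g fk_integral.
Qed.

Let rhs (V' : Z -> R -> R) (v : Z -> R -> R) x s :=
  V' x s * v x s + kappa * laplacian (fun y => v y s) x.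

(** The integral equation of the cut-off problems passes to the limit by
    dominated convergence in time, the majorant being given by the local
    bounds at x and at its neighbours. *)
Let solution_integral x (t : R) : 0 <= t ->
  mu.-integrable `[0, t] (EFin \o rhs Vp u x) /\
  u x t = u0 x + \int[mu]_(s in `[0, t]) rhs Vp u x s.
Proof.
move=> t0; pose K := \sum_(y <- neighbours x) (bound y t + bound x t).
have gB n y s : 0 <= s <= t -> `|g n%:R y s| <= bound y t.
  by move=> /andP[s0 st]; rewrite ger0_norm//; exact: g_bound.
have lapB n s : 0 <= s <= t -> `|laplacian (fun y => g n%:R y s) x| <= K.
  move=> st; rewrite laplacianE; apply: le_trans (ler_norm_sum _ _ _) _.
  apply: ler_sum => y _; apply: le_trans (ler_normB _ _) _.
  by apply: lerD; exact: gB.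
have rhs_cvg s : `[0, t]%classic s -> rhs (cut n%:R) (g n%:R) x s @[n --> \oo] --> rhs Vp u x s.
  rewrite /= in_itv/= => /andP[s0 st].
  have sumc : \sum_(y <- neighbours x) (g n%:R y s - g n%:R x s) @[n --> \oo] -->
      \sum_(y <- neighbours x) (u y s - u x s).
    apply: (@cvg_sum_seq _ _ _ (fun y n => g n%:R y s - g n%:R x s)) => y.
    by apply: cvgB; [have [] := solution_limit y s0|have [] := solution_limit x s0].
  have lapc : laplacian (fun y => g n%:R y s) x @[n --> \oo] --> laplacian (fun y => u y s) x.
    have Eg : (fun n => laplacian (fun y => g n%:R y s) x) =
        (fun n => \sum_(y <- neighbours x) (g n%:R y s - g n%:R x s)).
      by apply/funext => n; exact: laplacianE.
    by rewrite Eg [X in _ --> X](laplacianE (fun y => u y s) x).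
  apply: cvgD.
    by apply: cvgM; [exact: cut_cvg|have [] := solution_limit x s0].
  by apply: cvgM; [exact: cvg_cst|exact: lapc].
have mrhs n : measurable_fun (`[0, t]%classic : set (measurableTypeR R)) (rhs (cut n%:R) (g n%:R) x).
  apply: measurable_funD.
    by apply: measurable_funM; [apply: measurable_funTS; exact: measurable_cut|exact: measurable_g].
  apply: measurable_funM; first exact: measurable_cst.
  apply: (@eq_measurable_fun _ _ _ _ _ (fun s => \sum_(y <- neighbours x) (g n%:R y s - g n%:R x s))).
    by move=> s _; rewrite laplacianE.
  apply: measurable_sum => y; apply: measurable_funB; exact: measurable_g.
have [] := @dominated_Rintegral _ _ _ mu _ (@mt t)
  (fun n => rhs (cut n%:R) (g n%:R) x) (rhs Vp u x)
  (fun s => `|Vp x s| * bound x t + kappa * K).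
- exact: mrhs.
- by apply: (measurable_fun_cvg mrhs).
- exact: rhs_cvg.
- have i1 : mu.-integrable `[0, t] (EFin \o (fun s => `|Vp x s| * bound x t)).
    have := integrableZr (@mt t) (bound x t) (integrable_norm (iVp x t0)).
    exact: eq_integrable.
  have i2 : mu.-integrable `[0, t] (EFin \o (fun _ : R => kappa * K)).
    apply: continuous_compact_integrable; first exact: segment_compact.
    by apply: continuous_subspaceT => s; exact: cvg_cst.
  by have := integrableD (@mt t) i1 i2; apply: eq_integrable.
- move=> n s; rewrite /= in_itv/= => st; apply: le_trans (ler_normD _ _) _.
  rewrite !normrM (ger0_norm kappa_ge0); apply: lerD.
    by apply: ler_pM => //; [exact: cut_norm|exact: gB].
  by rewrite ler_wpM2l//; exact: lapB.
move=> iG cG; split=> //.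
have [_ gu] := solution_limit x t0.
have gE : (fun n => g n%:R x t) =
    (fun n => u0 x + \int[mu]_(s in `[0, t]) rhs (cut n%:R) (g n%:R) x s).
  by apply/funext => n; exact: (cut_equation x (ler0n R n) t0).
have cR : u0 x + \int[mu]_(s in `[0, t]) rhs (cut n%:R) (g n%:R) x s @[n --> \oo] -->
    u0 x + \int[mu]_(s in `[0, t]) rhs Vp u x s.
  by apply: cvgD; [exact: cvg_cst|exact: cG].
by rewrite gE in gu; exact: (cvg_unique _ gu cR).
Qed.

(** The integral equation makes the solution locally absolutely continuous and
    almost everywhere differentiable. Finiteness is assumed at integer times
    only, because the exceptional null set of a random potential must not
    depend on time. *)
Theorem feynman_kac_solves :
  (forall x (t : R), 0 <= t -> feynman_kac X P V u0 x t \is a fin_num) /\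
  solves_pam kappa V u0 (fun x t => fine (feynman_kac X P V u0 x t)).
Proof.
split=> [x t t0|]; first by have [] := solution_limit x t0.
have u_0 x : u x 0 = u0 x.
  have [_ ->] := solution_integral x (lexx 0).
  by rewrite set_itv1 Rintegral_set1 addr0.
have uE x (t : R) : 0 <= t -> u x t = u x 0 + \int[mu]_(s in `[0, t]) rhs Vp u x s.
  by move=> t0; have [_ ->] := solution_integral x t0; rewrite u_0.
have iG x (t : R) : 0 <= t -> mu.-integrable `[0, t] (EFin \o rhs Vp u x).
  by move=> t0; have [] := solution_integral x t0.
split=> [//|x t t0|x].
  exact: (indefinite_integral_abs_continuous (iG x) (uE x) t0).
have := indefinite_integral_derive (iG x) (uE x).
apply: filterS; first exact: (ae_filter_ringOfSetsType mu).
move=> t h t0; rewrite [X in is_derive _ _ _ X](_ : _ = rhs Vp u x t).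
  exact: (h t0).
by rewrite /rhs (VpE x t0) addrC.
Qed.

End Solution.

(** * Exponential moments of a stationary field *)

Section Jensen.
Context {R : realType}.
Local Notation mu := (@lebesgue_measure R).

(** The exponential function lies above its tangent at m; the inequality is
    arranged without a subtraction so that it can be integrated between
    nonnegative functions. *)
Lemma expR_tangent (a m f : R) : expR m * (1 + a * f) <= expR (a * f) + expR m * m.
Proof.
have := expR_ge1Dx (a * f - m).
have -> : expR (a * f) = expR m * expR (a * f - m) by rewrite -expRD subrKC.
have := expR_gt0 m; move: (expR m) (expR _) (a * f) => e x y e0 h.
rewrite -mulrDr ler_pM2l//; lra.
Qed.

(** Jensen's inequality for the uniform law on [0, a]: the tangent inequality
    at the point m, the value of the integral, is integrated over [0, a]. *)
Lemma expR_integral_le (a : R) (f : R -> R) : 0 < a ->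
  measurable_fun setT f -> (forall r, 0 <= f r) ->
  mu.-integrable `[0, a] (EFin \o f) ->
  ((expR (\int[mu]_(r in `[0, a]) f r))%:E <=
  (a^-1)%:E * \int[mu]_(r in `[0%R, a]) (expR (a * f r))%:E)%E.
Proof.
move=> a0 mf f0 intf; set m := (\int[mu]_(r in `[0, a]) f r).
have m0 : 0 <= m by apply: Rintegral_ge0 => r _; exact: f0.
have mt : measurable (`[0, a]%classic : set (measurableTypeR R)) by [].
have mD (g : R -> R) : measurable_fun setT g ->
    measurable_fun (`[0, a]%classic : set (measurableTypeR R)) (fun r => (g r)%:E).
  by move=> mg; apply: measurable_funTS; apply/measurable_EFinP.
have icst (c : R) : (\int[mu]_(r in `[0%R, a]) c%:E = (c * a)%:E)%E.
  transitivity (c%:E * mu (`[0%R, a]%classic : set (measurableTypeR R)))%E.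
    exact: integral_cst.
  by rewrite lebesgue_measure_itv/= lte_fin a0 sube0.
have maf : measurable_fun setT (fun r => a * f r).
  by apply: measurable_funM => //; exact: measurable_cst.
have meaf : measurable_fun setT (fun r => expR (a * f r)) by exact: measurableT_comp.
have fm : (\int[mu]_(r in `[0%R, a]) (f r)%:E = m%:E)%E.
  by rewrite /m /Rintegral fineK//; exact: integrable_fin_num intf.
have L : (\int[mu]_(r in `[0%R, a]) (expR m * (1 + a * f r))%:E = (expR m * (a + a * m))%:E)%E.
  transitivity (\int[mu]_(r in `[0%R, a]) ((expR m)%:E + (expR m * a)%:E * (f r)%:E))%E.
    by apply: eq_integral => r _; rewrite -EFinM -EFinD mulrDr mulr1 mulrA.
  rewrite ge0_integralD//; last 2 first.
  - by move=> r _; rewrite -EFinM lee_fin mulr_ge0// mulr_ge0 ?expR_ge0// ltW.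
  - by apply: emeasurable_funM; [exact: measurable_cst|exact: mD].
  rewrite ge0_integralZl//; last 3 first.
  - exact: mD.
  - by move=> r _; rewrite lee_fin.
  - by rewrite lee_fin mulr_ge0 ?expR_ge0// ltW.
  by rewrite icst fm -EFinM -EFinD mulrDr mulrA.
have RR : (\int[mu]_(r in `[0%R, a]) (expR (a * f r) + expR m * m)%:E =
    \int[mu]_(r in `[0%R, a]) (expR (a * f r))%:E + (expR m * m * a)%:E)%E.
  transitivity (\int[mu]_(r in `[0%R, a]) ((expR (a * f r))%:E + (expR m * m)%:E))%E.
    by apply: eq_integral => r _; rewrite EFinD.
  have e0 r : (0 <= (expR (a * f r))%:E)%E by rewrite lee_fin expR_ge0.
  have c0 : (0 <= (expR m * m)%:E)%E by rewrite lee_fin mulr_ge0 ?expR_ge0.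
  rewrite (ge0_integralD mu mt (fun r _ => e0 r) (mD _ meaf) (fun _ _ => c0)
    (measurable_cst (expR m * m)%:E)).
  by rewrite icst.
have : (\int[mu]_(r in `[0%R, a]) (expR m * (1 + a * f r))%:E <=
    \int[mu]_(r in `[0%R, a]) (expR (a * f r) + expR m * m)%:E)%E.
  apply: ge0_le_integral => //.
  - move=> r _; rewrite lee_fin mulr_ge0 ?expR_ge0// addr_ge0// mulr_ge0//; exact: ltW.
  - apply: (mD (fun r => expR m * (1 + a * f r))); apply: measurable_funM; first exact: measurable_cst.
    by apply: measurable_funD => //; exact: measurable_cst.
  - apply: (mD (fun r => expR (a * f r) + expR m * m)).
    by apply: measurable_funD => //; exact: measurable_cst.
  - by move=> r _; rewrite lee_fin expR_tangent.
rewrite L RR.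
have : (0 <= \int[mu]_(r in `[0%R, a]) (expR (a * f r))%:E)%E.
  by apply: integral_ge0 => r _; rewrite lee_fin expR_ge0.
case: (integral _ _ _) => [E| |] // E0 h.
  rewrite -EFinM lee_fin ler_pdivlMl//; move: h; rewrite -EFinD lee_fin.
  by rewrite mulrDr [expR m * (a * m)]mulrCA mulrA; lra.
by rewrite gt0_muley ?leey// lte_fin invr_gt0.
Qed.

End Jensen.

Section Stationarity.
Context (R : realType) (d : nat) (disp : measure_display)
  (Omega : measurableType disp) (P : probability Omega R)
  (xi : 'rV[int]_d -> R -> Omega -> R).
Hypotheses (xi_meas : measurable_field xi) (xi_stat : stationary P xi).

(** The field is jointly measurable for nonnegative times only, hence the
    truncation of the time variable. *)
Lemma measurable_field_comp d1 (S : measurableType d1) (a : S -> Omega) (b : S -> R) z :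
  measurable_fun setT a -> measurable_fun setT b ->
  measurable_fun setT (fun s => xi z (Num.max 0 (b s)) (a s)).
Proof.
move=> ma mb.
have mab : measurable_fun setT (fun s => (a s, Num.max 0 (b s))).
  apply: measurable_fun_pair => //; apply: measurable_maxr => //; exact: measurable_cst.
apply: (measurable_comp _ _ (xi_meas z) mab).
  by apply: measurableX => //; exact: measurable_itv.
by move=> _ [s _ <-]/=; split=> //=; rewrite in_itv/= andbT le_max lexx.
Qed.

Lemma measurable_field_at z (s : R) : 0 <= s -> measurable_fun setT (xi z s).
Proof.
move=> s0; have := @measurable_field_comp _ _ id (fun=> s) z.
by rewrite max_r//; apply => //; exact: measurable_cst.
Qed.

Lemma stationary_integral (phi : R -> \bar R) z (s : R) : 0 <= s ->
  measurable_fun setT phi -> (forall r, (0 <= phi r)%E) ->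
  (\int[P]_w phi (xi z s w) = \int[P]_w phi (xi 0 0 w))%E.
Proof.
move=> s0 mphi phi0.
have m1 := measurable_field_at z s0; have m0 := measurable_field_at 0 (lexx 0).
have E z' (s' : R) (m' : measurable_fun setT (xi z' s')) :
    (\int[P]_w phi (xi z' s' w) = \int[pushforward P (xi z' s')]_r phi r)%E.
  by rewrite ge0_integral_pushforward// preimage_setT.
rewrite (E _ _ m1) (E _ _ m0); apply: eq_measure_integral => B mB _.
have := xi_stat (A := [set f | B (f 0 0)]) _ z s0.
rewrite /shift_event/= !add0r; apply.
by apply: sub_sigma_algebra; exists 0, 0, B.
Qed.

End Stationarity.

Section ExponentialMoments.
Context (R : realType) (d : nat) (disp : measure_display)
  (Omega : measurableType disp) (Pr : probability Omega R)
  (xi : 'rV[int]_d -> R -> Omega -> R).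
Hypotheses (xi_meas : measurable_field xi) (xi_stat : stationary Pr xi).
Hypothesis xi_expmom : forall q : R, 0 <= q ->
  (\int[Pr]_w (expR (q * xi 0%R 0%R w))%:E < +oo)%E.
Context {disp' : measure_display} {T : measurableType disp'}.
Variables (kappa : R) (X : R -> T -> 'rV[int]_d) (P : 'rV[int]_d -> probability T R).
Hypothesis srw : simple_random_walk kappa X P.
Local Notation mu := (@lebesgue_measure R).
Notation Z := ('rV[int]_d).

Let pos z (q : Omega * R) : R := Num.max (xi z (Num.max 0 q.2) q.1) 0.

Let pos_ge0 z q : 0 <= pos z q. Proof. by rewrite le_max lexx orbT. Qed.

Let measurable_pos z : measurable_fun setT (pos z).
Proof.
apply: measurable_maxr; last exact: measurable_cst.
exact: measurable_field_comp.
Qed.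

Variables (a : R) (a_gt0 : 0 < a).

Let weight (q : Omega * R) v : \bar R := (expR (a * pos (walk X (a - q.2) v) q))%:E.

Let weight_ge0 q v : (0 <= weight q v)%E.
Proof. by rewrite lee_fin expR_ge0. Qed.

Let measurable_weight : measurable_fun setT (fun p : (Omega * R) * T => weight p.1 p.2).
Proof.
apply: (measurable_along_walk srw (a := fun p : (Omega * R) * T => a - p.1.2) (b := snd)
  (f := fun z p => (expR (a * pos z p.1))%:E)) => // [|z].
  apply: measurable_funB; first exact: measurable_cst.
  exact: (@measurableT_comp _ _ _ _ _ _ snd _ fst).
apply: measurable_EFin_exp; apply: measurable_funM; first exact: measurable_cst.
exact: (measurableT_comp (measurable_pos z)).
Qed.

(** The bound that Jensen's inequality gives for the Feynman-Kac expectation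
    of the positive part of the field, up to a factor: the exponential stands
    inside the time integral, so that a single site and a single time occur at
    once and stationarity applies. *)
Let path_moment x w : \bar R :=
  (\int[mu]_(r in `[0%R, a]) \int[P x]_v weight (w, r) v)%E.

Let measurable_moment x : measurable_fun setT (fun q => \int[P x]_v weight q v)%E.
Proof.
apply: (@measurable_integral2 _ _ _ _ _ (P x) (fun p : (Omega * R) * T => weight p.1 p.2)).
- exact: measurableT.
- exact: measurable_weight.
- by move=> p; exact: weight_ge0.
Qed.

Let moment_ge0 x q : (0 <= \int[P x]_v weight q v)%E.
Proof. by apply: integral_ge0 => v _; exact: weight_ge0. Qed.

Let measurable_path_moment x : measurable_fun setT (path_moment x).
Proof.
apply: (@measurable_integral2 _ _ _ _ _ mu (fun q => \int[P x]_v weight q v)%E).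
- exact: measurable_itv.
- exact: (measurable_moment x).
- by move=> q; exact: moment_ge0.
Qed.

Let phi r : \bar R := (expR (a * Num.max r 0))%:E.

Let phi_finite : (\int[Pr]_w phi (xi 0 0 w) < +oo)%E.
Proof.
have mx : measurable_fun setT (xi 0 0) by exact: measurable_field_at.
apply: (@le_lt_trans _ _ (\int[Pr]_w ((expR (a * xi 0 0 w))%:E + 1))%E); last first.
  rewrite ge0_integralD//.
  - rewrite lte_add_pinfty//; first exact: xi_expmom (ltW a_gt0).
    by rewrite integral_cst// mul1e (le_lt_trans (probability_le1 _ _))// ltry.
  - by apply: measurable_EFin_exp; apply: measurable_funM => //; exact: measurable_cst.
apply: ge0_le_integral => //.
- by move=> w _; rewrite lee_fin expR_ge0.
- apply: (measurable_EFin_exp (f := fun w => a * Num.max (xi 0 0 w) 0)).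
  apply: measurable_funM; first exact: measurable_cst.
  by apply: measurable_maxr => //; exact: measurable_cst.
- apply: emeasurable_funD; last exact: measurable_cst.
  by apply: measurable_EFin_exp; apply: measurable_funM => //; exact: measurable_cst.
move=> w _; rewrite /phi -EFinD lee_fin /Num.max; case: ltP => _.
  by rewrite mulr0 expR0 lerDr expR_ge0.
by rewrite lerDl.
Qed.

(** By Tonelli's theorem the expectation over the field can be taken first,
    with the path fixed; by stationarity it is the same for every site and
    time. *)
Let expectation_path_moment x : (\int[Pr]_w path_moment x w < +oo)%E.
Proof.
have mOm := @measurableT _ Omega.
have ma : measurable (`[0%R, a]%classic : set (measurableTypeR R)) by [].
rewrite (tonelli_dom Pr mu mOm ma (measurable_moment x) (moment_ge0 x)).
set M := (\int[Pr]_w phi (xi 0 0 w))%E.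
have E r : 0 <= r -> (\int[Pr]_w \int[P x]_v weight (w, r) v = M)%E.
  move=> r0.
  have mwr : measurable_fun setT (fun p : Omega * T => weight (p.1, r) p.2).
    have mp : measurable_fun setT (fun p : Omega * T => ((p.1, r), p.2)).
      by apply: measurable_fun_pair => //; apply: measurable_fun_pair => //; exact: measurable_cst.
    exact: (measurableT_comp measurable_weight mp).
  rewrite (tonelli_dom Pr (P x) mOm measurableT mwr (fun p => weight_ge0 _ _)).
  transitivity (\int[P x]_v cst M v)%E; last first.
    by rewrite (integral_cst (P x) measurableT M) [X in (_ * X)%E](probability_setT (P x)) mule1.
  apply: eq_integral => v _.
  transitivity (\int[Pr]_w phi (xi (walk X (a - r) v) r w))%E.
    by apply: eq_integral => w _; rewrite /weight /pos/= (max_r r0).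
  apply: (stationary_integral xi_meas xi_stat) => //; last first.
    by move=> s; rewrite lee_fin expR_ge0.
  apply: measurable_EFin_exp; apply: measurable_funM; first exact: measurable_cst.
  by apply: measurable_maxr => //; exact: measurable_cst.
rewrite [X in (X < _)%E](_ : _ = M * mu (`[0%R, a]%classic : set (measurableTypeR R)))%E; last first.
  rewrite -(integral_cst mu ma); apply: eq_integral => r.
  by rewrite inE/= in_itv/= => /andP[r0 _]; exact: E.
rewrite lebesgue_measure_itv/= lte_fin a_gt0 sube0.
have M0 : (0 <= M)%E by apply: integral_ge0 => w _; rewrite lee_fin expR_ge0.
apply: lte_mul_pinfty; [exact: M0| |exact: ltry].
by rewrite (ge0_fin_numE M0); exact: phi_finite.
Qed.

Let path_moment_ge0 x w : (0 <= path_moment x w)%E.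
Proof. by apply: integral_ge0 => r _; exact: moment_ge0. Qed.

Let ae_path_moment x : {ae Pr, forall w, (path_moment x w < +oo)%E}.
Proof.
have i : Pr.-integrable setT (path_moment x).
  apply/integrableP; split; first exact: measurable_path_moment.
  rewrite (_ : integral _ _ _ = (\int[Pr]_w path_moment x w)%E).
    exact: expectation_path_moment.
  by apply: eq_integral => w _; rewrite gee0_abs// path_moment_ge0.
have := integrable_ae measurableT i.
apply: filterS => w /(_ I).
by rewrite (ge0_fin_numE (path_moment_ge0 x w)).
Qed.

Variables (u0 : Z -> R) (M0 : R).
Hypotheses (u0_ge0 : forall x, 0 <= u0 x) (u0_le : forall x, u0 x <= M0).

(** Jensen's inequality along each path, followed by an exchange of the
    integrals over the path and over time. *)
Lemma feynman_kac_pos_le_moment x w :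
  (forall z (t : R), 0 <= t -> mu.-integrable `[0, t] (fun s => (xi z s w)%:E)) ->
  (feynman_kac X P (fun z s => Num.max (xi z s w) 0)%R u0 x a <=
   (M0 * a^-1)%:E * path_moment x w)%E.
Proof.
move=> iV; pose U z (s : R) : R := pos z (w, s).
have a0 := ltW a_gt0.
have M00 : 0 <= M0 := le_trans (u0_ge0 0) (u0_le 0).
have mU z : measurable_fun setT (U z).
  have mp : measurable_fun setT (fun s : R => (w, s)).
    by apply: measurable_fun_pair => //; exact: measurable_cst.
  exact: (measurableT_comp (measurable_pos z) mp).
have iU z (t : R) : 0 <= t -> mu.-integrable `[0, t] (EFin \o U z).
  move=> t0; have mt : measurable (`[0, t]%classic : set (measurableTypeR R)) by [].
  apply: (le_integrable mt _ _ (iV z t t0)).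
    by apply: measurable_funTS; apply/measurable_EFinP; exact: mU.
  move=> s; rewrite /= in_itv/= => /andP[s0 _].
  rewrite lee_fin /U /pos/= (max_r s0) /Num.max.
  by case: (ltP (xi z s w) 0) => // _; rewrite normr0.
have mw : measurable_fun setT (fun q : R * T => weight (w, q.1) q.2).
  have mp : measurable_fun setT (fun q : R * T => ((w, q.1), q.2)).
    by apply: measurable_fun_pair => //; apply: measurable_fun_pair => //; exact: measurable_cst.
  exact: (measurableT_comp measurable_weight mp).
have w0 (q : R * T) : (0 <= weight (w, q.1) q.2)%E by exact: weight_ge0.
have ma : measurable (`[0, a]%classic : set (measurableTypeR R)) by [].
rewrite (@feynman_kac_ext _ _ _ _ X P _ U); last first.
  by move=> z s /andP[s0 _]; rewrite /U /pos/= (max_r s0).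
rewrite (feynman_kacE srw mU u0 x a0).
have c0 : 0 <= M0 * a^-1 by rewrite mulr_ge0// invr_ge0.
rewrite /path_moment (tonelli_dom mu (P x) ma measurableT mw w0).
have mi : measurable_fun setT (fun v : T => \int[mu]_(r in `[0%R, a]) weight (w, r) v)%E.
  have mw' : measurable_fun setT (fun q : T * R => weight (w, q.2) q.1).
    have ms : measurable_fun setT (fun q : T * R => (q.2, q.1)) by exact: measurable_swap.
    exact: (measurableT_comp mw ms).
  exact: (measurable_integral2 mu ma mw' (fun q => weight_ge0 _ _)).
have i0 v : (0 <= \int[mu]_(r in `[0%R, a]) weight (w, r) v)%E.
  by apply: integral_ge0 => r _; exact: weight_ge0.
rewrite -(ge0_integralZl (P x) measurableT mi (fun v _ => i0 v)); last by rewrite lee_fin.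
apply: ge0_le_integral.
- exact: measurableT.
- by move=> v _; rewrite lee_fin mulr_ge0 ?expR_ge0.
- apply/measurable_EFinP; apply: measurable_funM.
    by apply: measurableT_comp => //; exact: (measurable_path_integral srw mU).
  exact: (measurable_along_walk srw (a := fun=> a) (b := id) (f := fun z _ => u0 z)).
- by apply: emeasurable_funM => //; exact: measurable_cst.
move=> v _; rewrite EFinM muleC.
have jen := expR_integral_le a_gt0 (measurable_along_path srw mU a v)
  (fun r => pos_ge0 _ _) (integrable_along_path srw mU iU v a0).
have uM : ((u0 (walk X a v))%:E <= M0%:E)%E by rewrite lee_fin.
have u00 : (0 <= (u0 (walk X a v))%:E)%E by rewrite lee_fin.
have e0 : (0 <= (expR (path_integral X U a v))%:E)%E by rewrite lee_fin expR_ge0.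
apply: (le_trans (lee_pmul u00 e0 uM jen)).
by rewrite muleA -EFinM.
Qed.

Lemma feynman_kac_pos_lty x : {ae Pr, forall w,
  (forall z (t : R), 0 <= t -> mu.-integrable `[0, t] (fun s => (xi z s w)%:E)) ->
  (feynman_kac X P (fun z s => Num.max (xi z s w) 0)%R u0 x a < +oo)%E}.
Proof.
have M00 : 0 <= M0 := le_trans (u0_ge0 0) (u0_le 0).
move: (ae_path_moment x); apply: filterS => w h iV.
apply: le_lt_trans (feynman_kac_pos_le_moment x iV) _.
rewrite lte_mul_pinfty ?lee_fin// mulr_ge0// invr_ge0; exact: ltW.
Qed.

End ExponentialMoments.

(** * The stationary random potential *)

Lemma ae_forall_count (R : realType) (disp : measure_display) (Omega : measurableType disp)
    (P : {measure set Omega -> \bar R}) (I : countType) (Q : I -> Omega -> Prop) :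
  (forall i, {ae P, forall w, Q i w}) -> {ae P, forall w, forall i, Q i w}.
Proof.
move=> PQ.
have : {ae P, forall w, forall n, if @unpickle I n is Some i then Q i w else True}.
  apply: ae_foralln => n; case: (unpickle n) => [i|]; first exact: PQ.
  exact: aeW.
by apply: filterS => w h i; have := h (pickle i); rewrite pickleK.
Qed.

Theorem theorem1p13 (R : realType) (d : nat) (d_gt0 : (0 < d)%N)
    (disp : measure_display) (Omega : measurableType disp)
    (P : probability Omega R) (xi : 'rV[int]_d -> R -> Omega -> R)
    (xi_meas : measurable_field xi)
    (xi_stat : stationary P xi) (xi_erg : ergodic P xi)
    (xi_nonconst : ~ constant_field P xi)
    (xi_L1 : (\int[P]_w `|xi 0 0 w|%:E < +oo)%E)
    (kappa : R) (kappa_ge0 : 0 <= kappa)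
    (disp' : measure_display) (T : measurableType disp')
    (PX : 'rV[int]_d -> probability T R) (X : R -> T -> 'rV[int]_d)
    (X_srw : simple_random_walk kappa X PX)
    (u0 : 'rV[int]_d -> R) (u0_ge0 : forall x, 0 <= u0 x)
    (u0_bounded : exists M : R, forall x, u0 x <= M)
    (xi_locint : {ae P, forall w, forall x (t : R), 0 <= t ->
      (@lebesgue_measure R).-integrable `[0, t]
        (fun s => (xi x s w)%:E)})
    (xi_expmom : forall q : R, 0 <= q ->
      (\int[P]_w (expR (q * xi 0%R 0%R w))%:E < +oo)%E) :
  {ae P, forall w,
    let u := feynman_kac X PX (fun x s => xi x s w) u0 in
    (forall x (t : R), 0 <= t -> u x t \is a fin_num) /\
    solves_pam kappa (fun x s => xi x s w) u0 (fun x t => fine (u x t))}.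

Proof.
have [M u0_le] := u0_bounded.
(* one null set for each site and each integer time horizon *)
have fin : {ae P, forall w, forall p : 'rV[int]_d * nat,
    (forall z (t : R), 0 <= t ->
      (@lebesgue_measure R).-integrable `[0, t] (fun s => (xi z s w)%:E)) ->
    (feynman_kac X PX (fun z s => Num.max (xi z s w) 0)%R u0 p.1 p.2.+1%:R < +oo)%E}.
  apply: ae_forall_count => -[x n] /=.
  exact: (feynman_kac_pos_lty xi_meas xi_stat xi_expmom X_srw).
apply: (@filterS2 _ _ (ae_filter_ringOfSetsType P) _ _ _ _ xi_locint fin) => w iV finw.
have H x (n : nat) : (feynman_kac X PX (fun z s => Num.max (xi z s w) 0)%R u0 x n.+1%:R < +oo)%E.
  exact: (finw (x, n) iV).
exact: (@feynman_kac_solves _ _ _ _ _ _ _ X_srw kappa_ge0 (fun x s => xi x s w) u0 iV u0_ge0 H).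
Qed.
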